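(* There are universal constants $c_1,c_2$ such that the following holds. Let $G$ be one of $GL(n,q)$, $U(n,q)$, $Sp(2n,q)$, or $O^{\pm}(n,q)$ (with $n$ a positive integer and $q$ a prime power). Then for any $r>0$, the probability that a uniformly random element of $G$ is regular semisimple on some subspace of codimension $\le c_1+r$ is at least $1-c_2/r^2$.
   Context: Subspaces are subspaces of the natural module $V$ of $G$: $V=\mathbb{F}_q^n$ for $GL(n,q)$ and $O^{\pm}(n,q)$, $V=\mathbb{F}_q^{2n}$ for $Sp(2n,q)$, $V=\mathbb{F}_{q^2}^n$ for $U(n,q)$ (the isometry group of a nondegenerate hermitian form). An element $\alpha\in G$ is regular semisimple on a subspace $W\subseteq V$ if $W$ is $\alpha$-invariant and $\alpha|_W$ is semisimple with distinct eigenvalues over the algebraic closure, i.e. the characteristic polynomial of $\alpha|_W$ is squarefree (the zero subspace is allowed). ''Universal'' means independent of $n$, $q$, $r$ and $G$. *)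

(* Defs.v *)
From HB Require Import structures.
From mathcomp Require Import all_boot all_order all_algebra.
From mathcomp Require Import boolp reals.

Set Implicit Arguments.
Unset Strict Implicit.
Unset Printing Implicit Defensive.

Import GRing.Theory Num.Theory.
Local Open Scope ring_scope.

(* Vectors are rows and matrices act on the right, u |-> u *m g; a subspace is
   the row space of a matrix. *)

Section Groups.
Variables (F : finFieldType) (m : nat).
Implicit Types (f : 'rV[F]_m -> 'rV[F]_m -> F) (Q : 'rV[F]_m -> F).

Definition general_linear : {set 'M[F]_m} := [set g | g \in unitmx].

Definition isometry_group f : {set 'M[F]_m} :=
  [set g in unitmx | [forall u, [forall v, f (u *m g) (v *m g) == f u v]]].

Definition orthogonal_group Q : {set 'M[F]_m} :=
  [set g in unitmx | [forall u, Q (u *m g) == Q u]].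

Definition polar Q (u v : 'rV[F]_m) : F := Q (u + v) - Q u - Q v.

(* polar Q is symmetric, so linearity in one argument is bilinearity. *)
Definition quadratic_form Q : Prop :=
  (forall (a : F) u, Q (a *: u) = a ^+ 2 * Q u) /\
  (forall u, scalar (polar Q u)).

(* No nonzero singular vector lies in the radical of polar Q.  If q is odd or m
   is even, this says that polar Q is nondegenerate; if q is even and m is odd,
   the radical of polar Q always has positive dimension, and this is the usual
   notion of a nonsingular form (the radical is then a nonsingular line). *)
Definition nondegenerate_quadratic Q : Prop :=
  forall v, (forall u, polar Q v u = 0) -> Q v = 0 -> v = 0.

End Groups.

(* The forms range over all nondegenerate ones of the given kind.  In the
   orthogonal case, the forms of plus type and those of minus type are thus both
   included, as are the two classes of forms when q and n are odd.
   #|F| = q (or q ^ 2) forces q to be a prime power. *)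
Inductive classical_group (q n : nat) :
    forall (F : finFieldType) (m : nat), {set 'M[F]_m} -> Prop :=
| ClassicalGL (F : finFieldType) :
    #|F| = q -> classical_group q n (general_linear F n)
| ClassicalU (F : finFieldType) (theta : {rmorphism F -> F})
    (f : {hermitian_sym 'rV[F]_n for theta}) :
    #|F| = (q ^ 2)%N -> (forall x, theta x = x ^+ q) -> is_unitary f ->
    classical_group q n (isometry_group f)
| ClassicalSp (F : finFieldType) (f : {skew_symmetric 'rV[F]_(2 * n)}) :
    #|F| = q -> is_psymplectic f -> classical_group q n (isometry_group f)
| ClassicalO (F : finFieldType) (Q : 'rV[F]_n -> F) :
    #|F| = q -> quadratic_form Q -> nondegenerate_quadratic Q ->
    classical_group q n (orthogonal_group Q).

Definition squarefree_poly (F : fieldType) (p : {poly F}) : Prop :=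
  forall u : {poly F}, size u != 1 -> ~~ (u ^+ 2 %| p).

Definition regular_semisimple_on (F : fieldType) (m : nat)
    (g : 'M[F]_m) (W : 'M[F]_m) : Prop :=
  stablemx W g /\ squarefree_poly (char_poly (restrictmx W g)).

Definition uniform_prob (R : realType) (T : finType) (G : {set T})
    (P : T -> Prop) : R :=
  #|[set g in G | `[< P g >]]|%:R / #|G|%:R.

(* Main.v *)
Require Import Defs.
From mathcomp Require Import all_boot all_order all_algebra.
From mathcomp Require Import boolp reals.
From mathcomp Require Import fingroup finfield.
From mathcomp Require Import ring lra zify.

(* Choose v in V and g in G uniformly at random and look at the cyclic
   submodule F[g]v. A module structure F[x]/(p) together with a form on it and
   an embedding into V is counted by Witt's theorem: the pairs (v, g) realising
   a given (p, form) number at most #|G|. For GL(V) there is no form and p is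
   equidistributed over the q^s monic polynomials of degree s. For an isometry
   group, let mu be the annihilator of v modulo the radical of F[g]v. It is
   self-reciprocal, and the form on F[g]v is determined by mu and by
   B(v g^i, v) for i <= (deg mu)/2, so both mu and the form have only half of
   the expected number of parameters. Write mu = h^2 m with m squarefree; then h
   and m are self-reciprocal as well, g is regular semisimple on a subspace of
   dimension deg m, and a square factor of degree 2k costs a factor of about
   q^(k/2) in the count. If F[g]v has dimension s, its radical has dimension at
   most n - s. Hence the codimension n - deg m is at most 2(n - s) + 2k, and it
   has an exponential tail uniformly in q and n; Chebyshev's inequality follows. *)

Set Implicit Arguments.
Unset Strict Implicit.
Unset Printing Implicit Defensive.
Import Order.TTheory GRing.Theory Num.Theory.
Local Open Scope ring_scope.

(** * Witt's extension theorem *)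

(* Treats the three kinds of isometry groups at once: N is the quadratic form
   and tau the identity (orthogonal), N u = B u u and tau x = x + theta x
   (unitary), N = tau = 0 and eps = -1 (symplectic). [fs_even] makes the form
   even in the sense needed for Witt's theorem; [fs_rad] leaves room for the
   radical of odd-dimensional quadratic forms in characteristic 2. *)
Record form_space (F : fieldType) (d : nat) := FormSpace {
  fs_theta : {rmorphism F -> F};
  fs_eps : F;
  fs_B : 'rV[F]_d -> 'rV[F]_d -> F;
  fs_N : 'rV[F]_d -> F;
  fs_tau : F -> F;
  fs_thetaK : involutive fs_theta;
  fs_eps2 : fs_eps * fs_eps = 1;
  fs_thetaE : fs_theta fs_eps = fs_eps;
  fs_BP : forall a u v w, fs_B (a *: u + v) w = a * fs_B u w + fs_B v w;
  fs_BC : forall u v, fs_B u v = fs_eps * fs_theta (fs_B v u);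
  fs_NZ : forall a u, fs_N (a *: u) = a * fs_theta a * fs_N u;
  fs_ND : forall u v, fs_N (u + v) = fs_N u + fs_N v + fs_tau (fs_B u v);
  fs_tauD : forall x y, fs_tau (x + y) = fs_tau x + fs_tau y;
  fs_tauM : forall a x, fs_tau (a * fs_theta a * x) = a * fs_theta a * fs_tau x;
  fs_tauC : forall x, fs_tau (fs_eps * fs_theta x) = fs_tau x;
  fs_even : forall u, exists k, fs_N u = fs_tau k /\
                        fs_B u u = k + fs_eps * fs_theta k;
  fs_rad : forall r, (forall w, fs_B r w = 0) -> fs_N r = 0 -> r = 0
}.

Section Witt.
Variables (F : fieldType) (d : nat) (X : form_space F d).
Local Notation V := 'rV[F]_d.
Local Notation th := (fs_theta X).
Local Notation ep := (fs_eps X).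
Local Notation B := (fs_B X).
Local Notation N := (fs_N X).
Local Notation tau := (fs_tau X).
Implicit Types (u v w x y z r : V) (a b c : F).

Definition in_rad r := forall w, B r w = 0.

Definition isometric (g : 'M[F]_d) :=
  (forall x y, B (x *m g) (y *m g) = B x y) /\ (forall x, N (x *m g) = N x).

Lemma fs_B0l w : B 0 w = 0.
Proof. by have := fs_BP X (-1) 0 0 w; rewrite scaler0 add0r mulN1r addNr. Qed.

Lemma fs_BDl u v w : B (u + v) w = B u w + B v w.
Proof. by have := fs_BP X 1 u v w; rewrite scale1r mul1r. Qed.

Lemma fs_BZl a u w : B (a *: u) w = a * B u w.
Proof. by have := fs_BP X a u 0 w; rewrite addr0 fs_B0l addr0. Qed.

Lemma fs_BNl u w : B (- u) w = - B u w.
Proof. by rewrite -scaleN1r fs_BZl mulN1r. Qed.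

Lemma fs_B0r w : B w 0 = 0.
Proof. by rewrite (fs_BC X) fs_B0l rmorph0 mulr0. Qed.

Lemma fs_BDr u v w : B w (u + v) = B w u + B w v.
Proof. by rewrite (fs_BC X) fs_BDl rmorphD mulrDr -!(fs_BC X). Qed.

Lemma fs_BZr a u w : B w (a *: u) = th a * B w u.
Proof. by rewrite (fs_BC X) fs_BZl rmorphM mulrCA -(fs_BC X). Qed.

Lemma fs_BNr u w : B w (- u) = - B w u.
Proof. by rewrite -scaleN1r fs_BZr rmorphN1 mulN1r. Qed.

Lemma fs_B_suml I (s : seq I) (f : I -> V) w : B (\sum_(i <- s) f i) w = \sum_(i <- s) B (f i) w.
Proof.
by elim: s => [|i s IH]; rewrite ?big_nil ?fs_B0l // !big_cons fs_BDl IH.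
Qed.

Lemma fs_B_sumr I (s : seq I) (f : I -> V) w : B w (\sum_(i <- s) f i) = \sum_(i <- s) B w (f i).
Proof.
by elim: s => [|i s IH]; rewrite ?big_nil ?fs_B0r // !big_cons fs_BDr IH.
Qed.

Lemma fs_BC0 u v : B u v = 0 -> B v u = 0.
Proof. by move=> h; rewrite (fs_BC X) h rmorph0 mulr0. Qed.

Lemma fs_tau0 : tau 0 = 0.
Proof. by have := fs_tauD X 0 0; rewrite addr0 => /eqP; rewrite addrC -subr_eq subrr => /eqP. Qed.

Lemma fs_tauN a : tau (- a) = - tau a.
Proof. by apply/eqP; rewrite -addr_eq0 -fs_tauD addNr fs_tau0. Qed.

Lemma fs_N0 : N 0 = 0.
Proof. by rewrite -(scale0r 0) fs_NZ !mul0r. Qed.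

Lemma fs_NN u : N (- u) = N u.
Proof. by rewrite -scaleN1r fs_NZ rmorphN1 mulrNN !mul1r. Qed.

Lemma fs_NB u v : N (u - v) = N u + N v - tau (B u v).
Proof. by rewrite fs_ND fs_NN fs_BNr fs_tauN. Qed.

Definition fs_BE := (fs_BDl, fs_BDr, fs_BNl, fs_BNr, fs_BZl, fs_BZr).

Lemma fs_eps_neq0 : ep != 0.
Proof. by apply/eqP=> h; have := fs_eps2 X; rewrite h mul0r => /esym/eqP; rewrite oner_eq0. Qed.

(** Homogeneity gives N(2r) = 4 N r, while additivity of N on the radical gives 2 N r. *)
Lemma in_rad_N2 r : in_rad r -> N r + N r = 0.
Proof.
move=> hr; have h : N (r + r) = N r + N r by rewrite fs_ND hr fs_tau0 addr0.
move: (h); rewrite -mulr2n -scaler_nat fs_NZ rmorph_nat => h2.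
have -> : N r + N r = 2 * 2 * N r - (N r + N r) by ring.
by rewrite h2 subrr.
Qed.

Lemma in_rad_inj r r' : in_rad r -> in_rad r' -> N r = N r' -> r = r'.
Proof.
move=> hr hr' e; apply/eqP; rewrite -subr_eq0; apply/eqP; apply: (fs_rad (f := X)).
  by move=> w; rewrite fs_BDl fs_BNl hr hr' subr0.
by rewrite fs_NB e hr fs_tau0 subr0 in_rad_N2.
Qed.

Definition gram : 'M[F]_d := \matrix_(i, j) B (delta_mx 0 i) (delta_mx 0 j).

Lemma gramE u v : B u v = (u *m gram *m (map_mx th v)^T) 0 0.
Proof.
rewrite [in LHS](row_sum_delta u) fs_B_suml -mulmxA mxE; apply: eq_bigr => i _.
rewrite fs_BZl; congr (_ * _).
rewrite [in LHS](row_sum_delta v) fs_B_sumr mxE; apply: eq_bigr => j _.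
by rewrite fs_BZr !mxE mulrC.
Qed.

Lemma in_radP r : in_rad r <-> r *m gram = 0.
Proof.
split=> [hr|h w]; last by rewrite gramE h mul0mx mxE.
apply/rowP=> j; rewrite [RHS]mxE -(hr (delta_mx 0 j)) gramE [RHS]mxE.
have dE i : (map_mx th (delta_mx 0 j : V))^T i 0 = (i == j)%:R.
  by rewrite !mxE eqxx /= rmorph_nat.
rewrite (bigD1 j) //= big1 ?addr0; first by rewrite dE eqxx mulr1.
by move=> i /negbTE hi; rewrite dE hi mulr0.
Qed.

(** As v lies outside H + rad, [v *m gram] lies outside the row space of [H *m gram], and some
    column of the cokernel separates them. Applying theta to that column compensates for the
    semilinearity of B in its second argument. *)
Lemma exists_dual k (H : 'M[F]_(k, d)) v c :
  (forall (y : 'rV_k) r, in_rad r -> v <> y *m H + r) ->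
  exists y, (forall x : 'rV_k, B (x *m H) y = 0) /\ B v y = c.
Proof.
move=> hv; set C := cokermx (H *m gram).
have : v *m gram *m C != 0.
  apply/negP; rewrite -submxE => /submxP[y]; rewrite mulmxA => e.
  apply: (hv y (v - y *m H)); last by rewrite addrC subrK.
  by apply/in_radP; rewrite mulmxBl e subrr.
case/rV0Pn => j hj; set e := (v *m gram *m C) 0 j in hj.
exists (map_mx th (((c / e) *: col j C)^T)).
have Bj x : B x (map_mx th (((c / e) *: col j C)^T)) =
    c / e * (x *m gram *m C) 0 j.
  rewrite gramE; set D := (map_mx th _)^T.
  have -> : D = (c / e) *: col j C.
    by apply/colP=> i; rewrite !mxE fs_thetaK.
  rewrite -scalemxAr [LHS]mxE; congr (_ * _).
  by rewrite !mxE; apply: eq_bigr => i _; rewrite [X in _ * X]mxE.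
split=> [x|]; rewrite Bj.
  by rewrite -!mulmxA [H *m _]mulmxA mulmx_coker mulmx0 mxE mulr0.
by rewrite divfK.
Qed.

Lemma isometric_unit g : isometric g -> g \in unitmx.
Proof.
move=> [gB gN]; rewrite -row_free_unit -kermx_eq0; apply/eqP/row_matrixP=> i.
rewrite row0; set x := row i _.
have xg : x *m g = 0 by apply/sub_kermxP; rewrite row_sub.
apply: (fs_rad (f := X)) => [w|]; first by rewrite -gB xg fs_B0l.
by rewrite -gN xg fs_N0.
Qed.

Lemma isometricM g h : isometric g -> isometric h -> isometric (g *m h).
Proof.
by move=> [gB gN] [hB hN]; split=> [x y|x]; rewrite !mulmxA ?hB ?hN.
Qed.

Lemma isometric1 : isometric 1%:M.
Proof. by split=> [x y|x]; rewrite !mulmx1. Qed.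

Lemma isometric_rad g x : isometric g -> in_rad (x *m g) <-> in_rad x.
Proof.
move=> gI; have gU := isometric_unit gI; case: gI => gB gN.
split=> h w; first by rewrite -gB h.
by rewrite -(mulmxKV gU w) gB h.
Qed.

Definition rank1 u y : 'M[F]_d := (\col_i B (delta_mx 0 i) u) *m y.

Lemma mul_rank1 x u y : x *m rank1 u y = B x u *: y.
Proof.
rewrite mulmxA -[RHS]mul_scalar_mx; congr (_ *m _); apply/rowP=> i; rewrite !ord1 !mxE eqxx mulr1n.
by rewrite [in RHS](row_sum_delta x) fs_B_suml; apply: eq_bigr => j _; rewrite fs_BZl !mxE.
Qed.

(** With u = v - w, the map is x -> x - (B x u / B v u) u. The hypotheses yield N u = tau (B v u)
    and B u u = B v u + B u v, which make it isometric. *)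
Lemma quasi_reflection v w : N v = N w -> B v v = B w w -> B v (v - w) != 0 ->
  exists g, [/\ isometric g, v *m g = w & forall x, B x (v - w) = 0 -> x *m g = x].
Proof.
move=> eN eB; set u := v - w => nz; set c := (B v u)^-1.
have wE : w = v - u by rewrite /u opprB addrC subrK.
clearbody u.
have Nu : N u = tau (B v u).
  have /eqP : N v = N v + N u - tau (B v u) by rewrite -fs_NB -wE.
  by rewrite -addrA addrC -subr_eq subrr eq_sym subr_eq0 => /eqP.
have Bu : B u u = B v u + B u v.
  have : B v v = B (v - u) (v - u) by rewrite -wE.
  rewrite !fs_BE => h; apply/eqP; rewrite -subr_eq0; apply/eqP.
  transitivity (B v v - B v u + (- B u v - - B u u) - B v v); first by ring.
  by rewrite -h subrr.
pose g := 1%:M - rank1 u (c *: u).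
have gE x : x *m g = x - (c * B x u) *: u.
  by rewrite mulmxBr mulmx1 mul_rank1 scalerA mulrC.
have nz' : th (B v u) != 0 by rewrite fmorph_eq0.
exists g; split=> [||x hx].
- split=> [x y|x]; rewrite !gE.
    rewrite !fs_BE Bu (fs_BC X u y) (fs_BC X u v) rmorphM /c fmorphV.
    by field; rewrite nz nz'.
  rewrite fs_NB fs_NZ Nu -fs_tauM fs_BZr -addrA -fs_tauN -fs_tauD.
  rewrite -[RHS]addr0 -fs_tau0; congr (_ + tau _).
  by rewrite rmorphM /c fmorphV; field; rewrite nz nz'.
- by rewrite gE mulVf // scale1r wE.
- by rewrite gE hx mulr0 scale0r subr0.
Qed.

(* An Eichler (Siegel) transformation; its values off the hyperplane orthogonal
   to u are not needed. *)
Lemma eichler u y : B u u = 0 -> N u = 0 -> B y u = 0 ->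
  exists g, isometric g /\
    forall x, B x u = 0 -> x *m g = x - (ep * B x y) *: u.
Proof.
move=> Buu Nu Byu; have Buy := fs_BC0 Byu.
have [k [Ny Byy]] := fs_even X y.
pose g := 1%:M + rank1 u (y - th k *: u) - rank1 y (ep *: u).
have gE x : x *m g = x + B x u *: y - (ep * B x y + th k * B x u) *: u.
  rewrite mulmxBr mulmxDr mulmx1 !mul_rank1 scalerBr !scalerA scalerDl opprD !addrA.
  by rewrite [RHS]addrAC (mulrC ep) (mulrC (th k)).
exists g; split=> [|x hx]; last first.
  by rewrite gE hx scale0r mulr0 !addr0.
split=> [x z|x]; rewrite !gE.
  rewrite !fs_BE Buu Byu Buy Byy (fs_BC X y z) (fs_BC X u z).
  rewrite !rmorphD !rmorphM fs_thetaK fs_thetaE.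
  have e2 := fs_eps2 X.
  transitivity (B x z + (1 - ep * ep) * (th (B z u)* B x y) + 0); last by rewrite e2; ring.
  by ring.
rewrite fs_NB fs_ND !fs_NZ Nu Ny mulr0 addr0 -fs_tauM fs_BDl !fs_BZr !fs_BZl Byu !mulr0 addr0.
rewrite -!addrA -fs_tauN -!fs_tauD; rewrite -[RHS]addr0; congr (_ + _).
transitivity (tau (th (B x u) * B x y - ep * th (th (B x u) * B x y))).
  congr tau; rewrite !rmorphD !rmorphM !fs_thetaK fs_thetaE; ring.
by rewrite fs_tauD fs_tauN fs_tauC subrr.
Qed.

(* If the quasi-reflection along u = v - w is not available, then u is singular.
   An Eichler transformation works unless v = c + a u with c in H + rad; in that
   case u lies in a hyperbolic plane (u, f) orthogonal to H, and v -> c + f -> w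
   is a product of two quasi-reflections. *)
Lemma witt_step k (H : 'M[F]_(k, d)) v w :
    N v = N w -> B v v = B w w ->
    (forall y : 'rV_k, B v (y *m H) = B w (y *m H)) ->
    (forall y : 'rV_k, in_rad (v - y *m H) <-> in_rad (w - y *m H)) ->
  exists g, [/\ isometric g, H *m g = H & v *m g = w].
Proof.
move=> eN eB eH eR.
have fixH g : (forall y : 'rV_k, y *m H *m g = y *m H) -> H *m g = H.
  by move=> hg; apply/row_matrixP=> i; rewrite row_mul !rowE.
have [[y hy]|nv] := pselect (exists y : 'rV_k, in_rad (v - y *m H)).
  (* Here v - yH and w - yH are radical vectors with the same N, so v = w. *)
  exists 1%:M; split; rewrite ?mulmx1 //; first exact: isometric1.
  apply: (@addIr _ (- (y *m H))); apply: in_rad_inj => //; first by apply/eR.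
  by rewrite !fs_NB eN eH.
have nw (y : 'rV_k) : ~ in_rad (w - y *m H) by move=> /eR h; apply: nv; exists y.
have {}nv (y : 'rV_k) : ~ in_rad (v - y *m H) by move=> h; apply: nv; exists y.
set u := v - w; have wE : w = v - u by rewrite /u opprB addrC subrK.
have Hu (y : 'rV_k) : B (y *m H) u = 0.
  by apply: fs_BC0; rewrite /u fs_BDl fs_BNl eH subrr.
have [Bvu|Bvu] := eqVneq (B v u) 0; last first.
  have [g [gI gv gfix]] := quasi_reflection eN eB Bvu.
  by exists g; split=> //; apply: fixH => y; rewrite gfix ?Hu.
clearbody u.
have Buv := fs_BC0 Bvu.
have Nu : N u = 0.
  move: eN; rewrite wE fs_NB Bvu fs_tau0 subr0 => /eqP.
  by rewrite addrC -subr_eq subrr => /eqP.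
have Buu : B u u = 0.
  move: eB; rewrite wE !fs_BE Bvu Buv oppr0 add0r opprK addr0 => /eqP.
  by rewrite addrC -subr_eq subrr => /eqP.
have [[y [a hr]]|nvu] := pselect (exists (y : 'rV_k) a, in_rad (v - y *m H - a *: u)); last first.
  have [|y [yH yv]] := @exists_dual (1 + k) (col_mx u H) v ep.
    move=> z r hr e; apply: nvu; exists (rsubmx z), (lsubmx z 0 0).
    suff -> : v - rsubmx z *m H - lsubmx z 0 0 *: u = r by [].
    have ez : z *m col_mx u H = lsubmx z 0 0 *: u + rsubmx z *m H.
      by rewrite -{1}[z]hsubmxK mul_row_col {1}[lsubmx z]mx11_scalar mul_scalar_mx.
    by rewrite e ez -[LHS]addrA -opprD [rsubmx z *m H + _]addrC addrAC subrr add0r.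
  have Bur : B u y = 0.
    by rewrite -(yH (row_mx 1%:M 0)) mul_row_col mul1mx mul0mx addr0.
  have [g [gI gE]] := eichler Buu Nu (fs_BC0 Bur).
  exists g; split=> //; last by rewrite gE // yv fs_eps2 scale1r wE.
  apply: fixH => z; rewrite gE //.
  by rewrite -[z *m H]add0r -(mul0mx 1 u) -mul_row_col yH mulr0 scale0r subr0.
pose c := v - a *: u.
have rc : in_rad (c - y *m H) by rewrite /c addrAC.
(* Since v and w = v - u lie outside H + rad, a is neither 0 nor 1; this is what makes the two
   quasi-reflections v -> z -> w available. *)
have a0 : a != 0.
  by apply/eqP=> a0; apply: (nv y); move: rc; rewrite /c a0 scale0r subr0.
have a1 : a - 1 != 0.
  apply/eqP=> /eqP; rewrite subr_eq0 => /eqP a1; apply: (nw y).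
  by move: rc; rewrite /c a1 scale1r wE.
have Bc x : B x c = B x (y *m H).
  by rewrite -[c](subrK (y *m H)) fs_BDr (fs_BC0 (rc x)) add0r.
have [|f0 [f0H f0u]] := @exists_dual k H u 1.
  move=> z r hr0 e; apply: (nv (y + a *: z)).
  suff -> : v - (y + a *: z) *m H = c - y *m H + a *: r.
    by move=> t; rewrite fs_BDl fs_BZl hr0 rc mulr0 addr0.
  rewrite mulmxDl -scalemxAl /c e scalerDr !opprD !addrA.
  by rewrite [RHS]addrAC subrK [RHS]addrAC.
have [k0 [Nf0 Bf0]] := fs_even X f0.
(* The multiple of u makes f singular without changing its pairings with u and H. *)
pose f := f0 - (ep * th k0) *: u.
have f0u' : B f0 u = ep by rewrite (fs_BC X) f0u rmorph1 mulr1.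
have fH (z : 'rV_k) : B (z *m H) f = 0 by rewrite /f fs_BDr fs_BNr fs_BZr f0H Hu mulr0 subr0.
have uf : B u f = 1 by rewrite /f fs_BDr fs_BNr fs_BZr f0u Buu mulr0 subr0.
have fu : B f u = ep by rewrite /f fs_BDl fs_BNl fs_BZl Buu mulr0 subr0.
have Nf : N f = 0.
  rewrite /f fs_NB fs_NZ Nu mulr0 addr0 fs_BZr f0u' rmorphM fs_thetaK fs_thetaE Nf0.
  by rewrite mulrAC fs_eps2 mul1r subrr.
have Bff : B f f = 0.
  rewrite /f !fs_BE Buu Bf0 f0u' f0u rmorphM fs_thetaK fs_thetaE.
  transitivity ((1 - ep * ep) * k0); first by ring.
  by rewrite fs_eps2 subrr mul0r.
have fc : B f c = 0 by rewrite Bc (fs_BC0 (fH _)).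
have cf := fs_BC0 fc.
have Nc : N c = N v.
  by rewrite /c fs_NB fs_NZ Nu mulr0 fs_BZr Bvu mulr0 fs_tau0 subr0 addr0.
have Bcc : B c c = B v v by rewrite /c !fs_BE Bvu Buv Buu; ring.
have Bcu : B c u = 0 by rewrite /c !fs_BE Bvu Buu; ring.
have vE : v = c + a *: u by rewrite /c subrK.
clearbody c f.
pose z := c + f.
have Nz : N v = N z by rewrite /z fs_ND Nf cf fs_tau0 !addr0.
have Bz : B v v = B z z by rewrite /z !fs_BE fc cf Bff !addr0.
have vz : v - z = a *: u - f by rewrite /z vE opprD addrACA subrr add0r.
have zw : z - w = f - (a - 1) *: u.
  by rewrite wE vE /z scalerBl scale1r -[c + _ - u]addrA opprD [c + f]addrC addrA addrK.
have [|g1 [g1I g1v g1f]] := quasi_reflection Nz Bz.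
  by rewrite vz fs_BDr fs_BNr fs_BZr Bvu mulr0 add0r oppr_eq0 vE fs_BDl fs_BZl cf uf mulr1 add0r.
have [|||g2 [g2I g2v g2f]] := @quasi_reflection z w.
- by rewrite -Nz.
- by rewrite -Bz.
- rewrite zw fs_BDr fs_BNr fs_BZr /z !fs_BDl Bff cf !add0r Bcu fu add0r oppr_eq0.
  by rewrite mulf_neq0 ?fs_eps_neq0 ?fmorph_eq0.
exists (g1 *m g2); split; first exact: isometricM.
  apply: fixH => x; rewrite mulmxA g1f ?g2f //.
    by rewrite zw fs_BDr fs_BNr fs_BZr fH Hu mulr0 subr0.
  by rewrite vz fs_BDr fs_BNr fs_BZr fH Hu mulr0 subr0.
by rewrite mulmxA g1v.
Qed.

(* The third hypothesis also takes care of injectivity, since N vanishes on no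
   nonzero vector of the radical. *)
Lemma witt k (A A' : 'M[F]_(k, d)) :
    (forall x y : 'rV_k, B (x *m A) (y *m A) = B (x *m A') (y *m A')) ->
    (forall x : 'rV_k, N (x *m A) = N (x *m A')) ->
    (forall x : 'rV_k, in_rad (x *m A) <-> in_rad (x *m A')) ->
  exists g, isometric g /\ A *m g = A'.
Proof.
elim: k A A' => [|k IH] A A' eB eN eR.
  by exists 1%:M; split; [exact: isometric1 | rewrite [LHS]flatmx0 [RHS]flatmx0].
rewrite -[A](@vsubmxK _ 1 k) -[A'](@vsubmxK _ 1 k) in eB eN eR *.
set a := usubmx _ in eB eN eR *; set a' := usubmx (m1 := 1) A' in eB eN eR *.
set H := dsubmx _ in eB eN eR *; set H' := dsubmx (m1 := 1) A' in eB eN eR *.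
have rowE c (y : 'rV_k) (b0 : V) (K : 'M[F]_(k, d)) :
    row_mx (c%:M : 'M_1) y *m col_mx b0 K = c *: b0 + y *m K.
  by rewrite mul_row_col mul_scalar_mx.
(* The induction hypothesis moves all rows but the first; [witt_step] then corrects the first row
   while fixing the others. *)
have [||| g [gI gH]] := IH H H'.
- by move=> x y; have := eB (row_mx 0%:M x) (row_mx 0%:M y); rewrite !rowE !scale0r !add0r.
- by move=> x; have := eN (row_mx 0%:M x); rewrite !rowE !scale0r !add0r.
- by move=> x; have := eR (row_mx 0%:M x); rewrite !rowE !scale0r !add0r.
have gHy (y : 'rV_k) : y *m H' = y *m H *m g by rewrite -gH mulmxA.
have [gB gN] := gI.
have [||y|y|h [hI hH ha]] := @witt_step k H' (a *m g) a'.
- by have := eN (row_mx 1%:M 0); rewrite gN !rowE !scale1r !mul0mx !addr0.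
- by have := eB (row_mx 1%:M 0) (row_mx 1%:M 0); rewrite gB !rowE !scale1r !mul0mx !addr0.
- by have := eB (row_mx 1%:M 0) (row_mx 0%:M y);
  rewrite {1}gHy gB !rowE !scale1r !scale0r !mul0mx !addr0 !add0r.
- have := eR (row_mx 1%:M (- y)); rewrite !rowE !scale1r !mulNmx => <-.
  by rewrite gHy -mulmxBl; apply: isometric_rad.
exists (g *m h); split; first exact: isometricM.
transitivity (col_mx (a *m g) (H *m g) *m h).
  by rewrite mulmxA; exact: (congr1 (mulmx^~ h) (mul_col_mx a H g)).
by rewrite mul_col_mx gH hH ha.
Qed.

End Witt.

(** * Counting fibres *)

(** Finite order makes orbits periodic: a finite Krylov matrix contains a whole orbit, and orbits
    agreeing from index 1 on agree at index 0. *)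
Lemma unitmx_torsion (F : finFieldType) n (g : 'M[F]_n.+1) :
  g \in unitmx -> exists2 k, (0 < k)%N & g ^+ k = 1.
Proof.
move=> gU; pose u : {unit 'M[F]_n.+1} := FinRing.Unit gU.
exists #[u]%g; first exact: order_gt0.
by have /(congr1 val) := expg_order u; rewrite FinRing.val_unitX.
Qed.

(* Fix (v0, g0) in S and let t move its orbit to that of (v, g); choosing t as a
   function of the orbit of (v, g), the map (v, g) |-> g0^-1 t g is injective. *)
Lemma card_fibre (F : finFieldType) n (G : {set 'M[F]_n.+1})
    (S : {set 'rV[F]_n.+1 * 'M[F]_n.+1}) :
  (forall g, g \in G -> g \in unitmx) ->
  {in G &, forall g h, g *m h \in G} ->
  {in G, forall g, invmx g \in G} ->
  (forall x, x \in S -> x.2 \in G) ->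
  {in S &, forall x y, exists2 t, t \in G &
     forall i, x.1 *m x.2 ^+ i *m t = y.1 *m y.2 ^+ i} ->
  (#|S| <= #|G|)%N.
Proof.
move=> GU GM GV SG St; have [->|[x0 x0S]] := set_0Vmem S; first by rewrite cards0.
pose orb (x : 'rV[F]_n.+1 * 'M[F]_n.+1) i := x.1 *m x.2 ^+ i.
pose P (K : nat -> 'rV[F]_n.+1) t := t \in G /\ forall i, orb x0 i *m t = K i.
(* The choice depends on the orbit only; the default 0 is never taken at orbits from [S]. *)
pose T K := if pselect (exists t, P K t) is left h then projT1 (cid h) else 0.
have TP x : x \in S -> P (orb x) (T (orb x)).
  move=> xS; rewrite /T; case: pselect => [h|[]]; first exact: (projT2 (cid h)).
  by have [t tG tE] := St x0 x x0S xS; exists t; split.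
pose psi x := invmx x0.2 *m T (orb x) *m x.2.
have x0U := GU _ (SG _ x0S).
have psiE x i : x \in S -> orb x0 i.+1 *m psi x = orb x i.+1.
  move=> xS; have [_ tE] := TP x xS.
  rewrite /psi /orb !mulmxA exprSr mulmxA mulmxK // -/(orb x0 i) tE.
  by rewrite exprSr mulmxA.
(* [psi x] maps the orbit of x0 to that of x from index 1 on, so it determines the orbit of x, hence
   v and [T]; cancelling [T] recovers g. *)
have psi_inj : {in S &, injective psi}.
  move=> x y xS yS e.
  have oS i : orb x i.+1 = orb y i.+1 by rewrite -(psiE x) // -(psiE y) // e.
  have [a a0 xa] := unitmx_torsion (GU _ (SG _ xS)).
  have [b b0 yb] := unitmx_torsion (GU _ (SG _ yS)).
  have o0 : orb x 0%N = orb y 0%N.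
    have := oS (a * b).-1; rewrite prednK ?muln_gt0 ?a0 // /orb.
    by rewrite exprM xa expr1n mulnC exprM yb expr1n.
  have oE : orb x = orb y by apply: funext => -[].
  have [TG _] := TP x xS.
  have := e; rewrite /psi -!mulmxA -oE.
  have xU : invmx x0.2 \in unitmx by rewrite unitmx_inv.
  move/(can_inj (mulKmx xU))/(can_inj (mulKmx (GU _ TG))) => e2.
  move: o0 e2; rewrite /orb !expr0 !mulmx1.
  by case: (x) (y) => [? ?] [? ?] /= -> ->.
rewrite -(card_in_imset psi_inj); apply: subset_leq_card.
apply/subsetP=> _ /imsetP[x xS ->].
by rewrite /psi !GM ?GV ?SG //; case: (TP x xS).
Qed.

Lemma card_bigcup_le (T I : finType) (S : {set T}) (A : I -> {set T}) :
  (forall x, x \in S -> exists i, x \in A i) -> (#|S| <= \sum_i #|A i|)%N.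
Proof.
move=> SA; apply: (@leq_trans #|\bigcup_i A i|).
  apply/subset_leq_card/subsetP=> x /SA[i xi].
  by apply/bigcupP; exists i.
elim/big_rec2: _ => [|i m C _ IH]; first by rewrite cards0.
by rewrite cardsU; apply: leq_trans (leq_subr _ _) _; rewrite leq_add2l.
Qed.

Lemma card_codes (T C : finType) (S : {set T}) (code : T -> C -> Prop) b :
  (forall x, x \in S -> exists c, code x c) ->
  (forall c, #|[set x in S | `[< code x c >]]| <= b)%N ->
  (#|S| <= #|C| * b)%N.
Proof.
move=> hS hb; rewrite -sum_nat_const.
apply: leq_trans (leq_sum _ (fun c _ => hb c)); apply: card_bigcup_le => x xS.
by have [c cx] := hS x xS; exists c; rewrite inE xS; apply/asboolP.
Qed.

(** * Ideals and square divisors in F[x] *)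

Section Ideal.
Variable F : fieldType.
Implicit Types f g p h m u : {poly F}.

Lemma poly_ideal_gen (I : {poly F} -> Prop) :
  (exists2 f, f != 0 & I f) -> (forall f g, I f -> I g -> I (f + g)) ->
  (forall f a, I f -> I (a * f)) ->
  exists2 p, p \is monic & forall f, I f <-> p %| f.
Proof.
move=> [f0 f0n If0] ID IM.
pose P k := `[< exists f, [/\ f != 0, I f & size f = k] >].
have exP : exists k, P k by exists (size f0); apply/asboolP; exists f0.
have [p0 [p0n Ip0 sp0]] : exists f, [/\ f != 0, I f & size f = ex_minn exP].
  by case: ex_minnP => k /asboolP.
exists ((lead_coef p0)^-1 *: p0).
  by rewrite monicE lead_coefZ mulVf // lead_coef_eq0.
have lc0 : (lead_coef p0)^-1 != 0 by rewrite invr_eq0 lead_coef_eq0.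
move=> f; rewrite dvdpZl //; split; last first.
  by move=> /dvdpP[q ->]; apply: IM.
move=> If; rewrite /dvdp; apply: contraT; rewrite /= => r0.
have Ir : I (f %% p0).
  have -> : f %% p0 = f + (- (f %/ p0)) * p0 by rewrite mulNr; apply/eqP; rewrite eq_sym subr_eq addrC -divp_eq.
  by apply: ID => //; apply: IM.
have := ltn_modp f p0; rewrite p0n ltnNge sp0; case/negP.
case: ex_minnP => k _; apply; apply/asboolP; exists (f %% p0); split=> //.
Qed.

(** Take h of maximal size with h^2 dividing p: a square factor u^2 of the quotient would allow h u
    in place of h. *)
Lemma max_square_divisor p : p != 0 ->
  exists h m, [/\ h \is monic, p = h ^+ 2 * m & squarefree_poly m].
Proof.
move=> p0.
pose P k := `[< exists h, [/\ h \is monic, h ^+ 2 %| p & size h = k] >].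
have exP : exists k, P k.
  by exists 1%N; apply/asboolP; exists 1; rewrite monic1 expr1n dvd1p size_poly1.
have bP k : P k -> (k <= size p)%N.
  move=> /asboolP[h [hm hp <-]]; apply: leq_trans (dvdp_leq p0 hp).
  by rewrite dvdp_leq // ?expf_neq0 ?monic_neq0 // expr2 dvdp_mulr.
have [h [hm /dvdpP[m mE] sh]] : exists h, [/\ h \is monic, h ^+ 2 %| p & size h = ex_maxn exP bP].
  by case: ex_maxnP => k /asboolP.
exists h, m; split=> //; first by rewrite mulrC.
move=> u su; apply/negP=> um.
have m0 : m != 0 by apply: contraNneq p0 => m0; rewrite mE m0 mul0r.
have u0 : u != 0 by apply: contraTneq um => ->; rewrite expr0n /= dvd0p.
have h0 := monic_neq0 hm.
move: sh; case: ex_maxnP => k _ kmax shk.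
have : P (size (h * ((lead_coef u)^-1 *: u))).
  apply/asboolP; exists (h * ((lead_coef u)^-1 *: u)); split=> //.
    by rewrite monicMl // monicE lead_coefZ mulVf // lead_coef_eq0.
  rewrite exprMn exprZn -scalerAr dvdpZl ?expf_neq0 ?invr_eq0 ?lead_coef_eq0 //.
  by rewrite mE mulrC dvdp_mul.
move/kmax; rewrite -scalerAr size_scale ?invr_eq0 ?lead_coef_eq0 // size_mul //.
have : (0 < size u)%N by rewrite lt0n size_poly_eq0.
have : (0 < size h)%N by rewrite lt0n size_poly_eq0.
move: su; rewrite -shk; move: (size u) (size h) => a b; lia.
Qed.
End Ideal.

(** * Self-reciprocal polynomials *)

Section Reciprocal.
Variables (F : fieldType) (th : {rmorphism F -> F}).
Implicit Types f g h m p : {poly F}.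

(* The theta-twisted reversal x^d theta(f)(1/x) of a polynomial of degree at
   most d. *)
Definition srev d f := \poly_(i < d.+1) th f`_(d - i).

Lemma srevD d f g : srev d (f + g) = srev d f + srev d g.
Proof.
apply/polyP=> i; rewrite coefD !coef_poly; case: ifP; rewrite ?addr0 //.
by rewrite coefD rmorphD.
Qed.

Lemma srevZ d a f : srev d (a *: f) = th a *: srev d f.
Proof.
apply/polyP=> i; rewrite coefZ !coef_poly; case: ifP; rewrite ?mulr0 //.
by rewrite coefZ rmorphM.
Qed.

Lemma srev_sum d I (r : seq I) (E : I -> {poly F}) :
  srev d (\sum_(i <- r) E i) = \sum_(i <- r) srev d (E i).
Proof.
elim: r => [|i r IH]; last by rewrite !big_cons srevD IH.
by rewrite !big_nil -[0 in LHS](scale0r 0) srevZ rmorph0 scale0r.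
Qed.

Lemma srevXn d k : (k <= d)%N -> srev d 'X^k = 'X^(d - k).
Proof.
move=> kd; apply/polyP=> i; rewrite coef_poly !coefXn rmorph_nat ltnS.
case: leqP => id; last by rewrite (gtn_eqF (leq_ltn_trans (leq_subr k d) id)).
by congr (_%:R); apply/eqP/eqP; lia.
Qed.

Lemma poly_sum k p : (size p <= k.+1)%N -> p = \sum_(j < k.+1) p`_j *: 'X^j.
Proof.
move=> sp; rewrite -poly_def; apply/polyP=> i; rewrite coef_poly.
by case: ltnP => // hi; rewrite nth_default // (leq_trans sp).
Qed.

Lemma srevE d f : (size f <= d.+1)%N ->
  srev d f = \sum_(j < d.+1) th f`_j *: 'X^(d - j).
Proof.
move=> sf; rewrite {1}(poly_sum sf) srev_sum.
by apply: eq_bigr => j _; rewrite srevZ srevXn // -ltnS.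
Qed.

Lemma srevM d e f g : (size f <= d.+1)%N -> (size g <= e.+1)%N ->
  srev (d + e) (f * g) = srev d f * srev e g.
Proof.
move=> sf sg; rewrite (srevE sf) (srevE sg).
rewrite {1}(poly_sum sf) {1}(poly_sum sg) !big_distrlr /= srev_sum.
apply: eq_bigr => i _; rewrite srev_sum; apply: eq_bigr => j _.
rewrite -!scalerAl -!scalerAr !scalerA srevZ -!exprD rmorphM srevXn.
  by congr (_ *: 'X^_); have := ltn_ord i; have := ltn_ord j; lia.
by have := ltn_ord i; have := ltn_ord j; lia.
Qed.

Lemma size_srev d f : (size (srev d f) <= d.+1)%N.
Proof. exact: size_poly. Qed.

Lemma size_srev_eq d f : f`_0 != 0 -> size (srev d f) = d.+1.
Proof.
move=> f0; apply/eqP; rewrite eqn_leq size_srev ltnNge; apply/negP=> h.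
have : (srev d f)`_d = 0 by rewrite nth_default.
by rewrite coef_poly ltnSn subnn => /eqP; rewrite fmorph_eq0 (negPf f0).
Qed.

Definition selfrecip f := srev (size f).-1 f %= f.

(** After removal of the gcd, b' is coprime to a', so b'^2 divides m and b' is constant. *)
Lemma squarefree_dvd a b m : a != 0 -> squarefree_poly m -> b ^+ 2 %| a ^+ 2 * m -> b %| a.
Proof.
move=> a0 sm h; set g := gcdp a b.
have g0 : g != 0 by rewrite gcdp_eq0 negb_and a0.
have /dvdpP[a' aE] : g %| a := dvdp_gcdl a b.
have /dvdpP[b' bE] : g %| b := dvdp_gcdr a b.
have cop : coprimep a' b'.
  have := eqpxx g; rewrite {1}/g {1}aE {1}bE => e.
  have : gcdp (a' * g) (b' * g) %= g := e.
  rewrite -(eqp_ltrans (mulp_gcdl a' b' g)) -{2}[g]mul1r eqp_mul2r //.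
  by rewrite coprimep_def => /eqp_size ->; rewrite size_poly1.
have : b' ^+ 2 %| m.
  move: h; rewrite aE bE !exprMn [a' ^+ 2 * _ * m]mulrAC dvdp_mul2r ?expf_neq0 //.
  by rewrite Gauss_dvdpr // coprimep_expl // coprimep_expr // coprimep_sym.
move=> bm; have sb : size b' == 1.
  by apply: contraT => sb; have := sm b' sb; rewrite bm.
rewrite aE bE dvdp_mul2r //.
by move/eqP/eqP: sb => /size_poly1P[c c0 ->]; rewrite -alg_polyC dvdpZl // dvd1p.
Qed.

(** Reversal is multiplicative, so rev(h)^2 divides h^2 m and rev(h) divides h by [squarefree_dvd].
    The constant term of h is nonzero, so the sizes agree; cancelling h^2 settles m. *)
Lemma selfrecip_square_part h m : h \is monic -> m \is monic -> squarefree_poly m ->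
  selfrecip (h ^+ 2 * m) -> selfrecip h /\ selfrecip m.
Proof.
move=> hm mm sqm; rewrite /selfrecip.
have h0 := monic_neq0 hm; have m0 := monic_neq0 mm.
set k := (size h).-1; set t := (size m).-1.
have sh : size h = k.+1 by rewrite prednK // lt0n size_poly_eq0.
have sm : size m = t.+1 by rewrite prednK // lt0n size_poly_eq0.
have shh : size (h ^+ 2) = (k + k).+1.
  by rewrite expr2 size_mul // sh; lia.
have -> : (size (h ^+ 2 * m)).-1 = (k + k + t)%N.
  by rewrite size_mul ?expf_neq0 // shh sm; lia.
have sM : srev (k + k + t) (h ^+ 2 * m) = srev k h ^+ 2 * srev t m.
  by rewrite srevM ?shh ?sm // !expr2 srevM ?sh.
rewrite sM => e.
have hrh : srev k h %| h.
  apply: (squarefree_dvd h0 sqm); rewrite -(eqp_dvdr _ e).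
  by rewrite dvdp_mulr.
have h2m0 : h ^+ 2 * m != 0 by rewrite mulf_neq0 ?expf_neq0.
have c0 : (h ^+ 2 * m)`_0 != 0.
  have : size (srev (k + k + t) (h ^+ 2 * m)) = (k + k + t).+1.
    by rewrite sM (eqp_size e) size_mul ?expf_neq0 // shh sm; lia.
  move=> ss; apply/eqP => z.
  have : lead_coef (srev (k + k + t) (h ^+ 2 * m)) = 0.
    by rewrite lead_coefE ss /= coef_poly ltnSn subnn z rmorph0.
  by move/eqP; rewrite lead_coef_eq0 -size_poly_eq0 ss.
have hc0 : h`_0 != 0.
  by apply: contraNneq c0; rewrite -!horner_coef0 hornerM horner_exp => ->; rewrite expr0n mul0r.
have eh : srev k h %= h by rewrite -(dvdp_size_eqp hrh) size_srev_eq // sh.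
split=> //; rewrite -(eqp_mul2l _ _ (expf_neq0 2 h0)).
by apply: eqp_trans e; apply: eqp_mulr; rewrite eqp_sym eqp_exp.
Qed.

(** For monic f the relation reads theta(f_(d-i)) = theta(f_0) f_i, so the lower half of the
    coefficients determines the upper half. *)
Lemma selfrecip_inj d f g : f \is monic -> g \is monic ->
  size f = d.+1 -> size g = d.+1 -> selfrecip f -> selfrecip g ->
  (forall i, (i <= d./2)%N -> f`_i = g`_i) -> f = g.
Proof.
move=> fm gm sf sg; rewrite /selfrecip sf sg /= => rf rg e.
have rE p i : p \is monic -> size p = d.+1 -> srev d p %= p -> (i <= d)%N ->
    th p`_(d - i) = th p`_0 * p`_i.
  move=> pm sp /eqpfP; rewrite (monicP pm) divr1 => h id.
  have cE j : (j <= d)%N -> th p`_(d - j) = lead_coef (srev d p) * p`_j.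
    by move=> jd; have /(congr1 (coefp j)) := h; rewrite /= coefZ coef_poly ltnS jd.
  rewrite (cE i id) -[in th p`_0](subnn d) (cE d) //.
  by have := monicP pm; rewrite lead_coefE sp /= => ->; rewrite mulr1.
apply/polyP=> i; have [id|di] := leqP i d; last by rewrite !nth_default ?sf ?sg.
have [i2|i2] := leqP i d./2; first exact: e.
have ddi : (d - i <= d./2)%N by have := odd_double_half d; lia.
apply: (fmorph_inj th); rewrite -[i](subKn id) !rE ?leq_subr //.
by rewrite !e.
Qed.
End Reciprocal.

(** * Cyclic submodules *)

Section Cyclic.
Variables (F : fieldType) (n : nat).
Local Notation V := 'rV[F]_n.+1.
Implicit Types (v y : V) (g : 'M[F]_n.+1) (f p m : {poly F}).

(** The action of f on v in the F[x]-module defined by g. *)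
Definition pact g v f : V := v *m horner_mx g f.

Lemma pactD g v f1 f2 : pact g v (f1 + f2) = pact g v f1 + pact g v f2.
Proof. by rewrite /pact rmorphD mulmxDr. Qed.

Lemma pactM g v f1 f2 : pact g v (f1 * f2) = pact g (pact g v f1) f2.
Proof. by rewrite /pact rmorphM mulmxA. Qed.

Lemma pactX g v i : pact g v 'X^i = v *m g ^+ i.
Proof. by rewrite /pact rmorphXn /= horner_mx_X. Qed.

Lemma pact0l g f : pact g 0 f = 0.
Proof. by rewrite /pact mul0mx. Qed.

Lemma pact_char g v : pact g v (char_poly g) = 0.
Proof. by rewrite /pact Cayley_Hamilton mulmx0. Qed.

Lemma pactE g v f : pact g v f = \sum_(i < size f) f`_i *: (v *m g ^+ i).
Proof.
rewrite -[f in LHS]coefK poly_def /pact rmorph_sum mulmx_sumr.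
by apply: eq_bigr => i _; rewrite /= horner_mxZ -scalemxAr; congr (_ *: _); exact: pactX.
Qed.

Definition krylov k g v : 'M[F]_(k, n.+1) := \matrix_(i < k) (v *m g ^+ i).

Lemma mul_krylov k g v (x : 'rV_k) : x *m krylov k g v = pact g v (rVpoly x).
Proof.
rewrite mulmx_sum_row /rVpoly poly_def /pact rmorph_sum mulmx_sumr.
apply: eq_bigr => i _; rewrite rowK /= horner_mxZ -scalemxAr valK /=.
by congr (_ *: _); rewrite -pactX.
Qed.

Lemma size_rVpoly k (x : 'rV[F]_k) : (size (rVpoly x) <= k)%N.
Proof. exact: size_poly. Qed.

Lemma annihilator g v : exists2 p, p \is monic & forall f, pact g v f = 0 <-> p %| f.
Proof.
apply: poly_ideal_gen.
- by exists (char_poly g); rewrite ?pact_char // monic_neq0 ?char_poly_monic.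
- by move=> f1 f2 h1 h2; rewrite pactD h1 h2 addr0.
- by move=> f a h; rewrite mulrC pactM h pact0l.
Qed.

(** A linear relation among the rows is a polynomial of size at most k killing v, too small to be a
    nonzero multiple of p. *)
Lemma krylov_free k g v p : (forall f, pact g v f = 0 -> p %| f) ->
  size p = k.+1 -> row_free (krylov k g v).
Proof.
move=> hp sp; rewrite -kermx_eq0; apply/eqP/row_matrixP=> i; rewrite row0.
set x := row i _; have : x *m krylov k g v = 0 by apply/sub_kermxP; rewrite row_sub.
rewrite mul_krylov => /hp h; apply: (can_inj rVpolyK); rewrite linear0.
by apply: contraTeq h => x0; apply/negP=> /(dvdp_leq x0); rewrite sp ltnNge size_rVpoly.
Qed.

(** By Cayley-Hamilton for A, [char_poly A] kills y, so m divides it; both are monic of the same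
    size. *)
Lemma char_poly_cyclic r (K : 'M[F]_(r, n.+1)) (A : 'M[F]_r) g y m (z : 'rV_r) :
  K *m g = A *m K -> y = z *m K -> (forall f, pact g y f = 0 -> m %| f) ->
  m \is monic -> size m = r.+1 -> char_poly A = m.
Proof.
move=> KA yE hm mm sm.
have mA : m %| char_poly A.
  case: r K A z KA yE sm => [|r] K A z KA yE sm.
    by move/eqP: sm => /size_poly1P[c c0 ->]; rewrite -alg_polyC dvdpZl // dvd1p.
  apply: hm; rewrite yE /pact -mulmxA.
  suff -> f : K *m horner_mx g f = horner_mx A f *m K.
    by rewrite Cayley_Hamilton mul0mx mulmx0.
  elim/poly_ind: f => [|f c IH]; first by rewrite !rmorph0 mul0mx mulmx0.
  rewrite !rmorphD !rmorphM /= !horner_mx_X !horner_mx_C.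
  rewrite mulmxDr mulmxDl mulmxA IH -!mulmxA KA; congr (_ + _).
  by rewrite mul_scalar_mx mul_mx_scalar.
apply/eqP; rewrite -eqp_monic ?char_poly_monic // eqp_sym.
by rewrite -(dvdp_size_eqp mA) sm size_char_poly.
Qed.

(** W is spanned by the first r orbit vectors; reduction modulo m shows that it is the full cyclic
    submodule, on which g has characteristic polynomial m. *)
Lemma cyclic_regular g y m r : m \is monic -> size m = r.+1 -> squarefree_poly m ->
  (forall f, pact g y f = 0 <-> m %| f) ->
  exists W : 'M[F]_n.+1, \rank W = r /\ regular_semisimple_on g W.
Proof.
move=> mm sm sqm hm; set K := krylov r g y.
have Kfree : row_free K by apply: (krylov_free (p := m)) => // f /hm.
have pactK f : (pact g y f <= K)%MS.
  have m0 := monic_neq0 mm.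
  have -> : pact g y f = pact g y (f %% m).
    rewrite [in LHS](divp_eq f m) pactD [_ * m]mulrC pactM.
    have -> : pact g y m = 0 by apply/hm.
    by rewrite pact0l add0r.
  have sr : (size (f %% m)%R <= r)%N by rewrite -ltnS -sm ltn_modp.
  by apply/submxP; exists (poly_rV (f %% m)); rewrite mul_krylov poly_rV_K.
have rW : \rank <<K>> = r by rewrite genmxE; apply/eqP.
have st : stablemx <<K>> g.
  rewrite (eqmx_stable _ (genmxE K)); apply/row_subP=> i.
  rewrite row_mul rowK; have -> : y *m g ^+ i *m g = pact g y 'X^(i.+1).
    by rewrite pactX exprSr mulmxA.
  exact: pactK.
exists <<K>>%MS; split=> //; split=> //.
have yK : (y <= row_base <<K>>)%MS.
  rewrite eq_row_base genmxE; have := pactK 1.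
  by rewrite /pact rmorph1 mulmx1.
have [z yE] := submxP yK.
rewrite (char_poly_cyclic (K := row_base <<K>>%MS) (g := g) (y := y) (m := m) (z := z)) //.
- by rewrite /conjmx mulmxKpV // stablemx_row_base.
- by move=> f /hm.
- by rewrite rW.
Qed.

(* If p = q m is the annihilator of v, the submodule generated by v q(g) has
   annihilator m. *)
Lemma exists_regular g v m : m \is monic -> squarefree_poly m ->
  (forall f, pact g v f = 0 -> m %| f) ->
  exists W : 'M[F]_n.+1, \rank W = (size m).-1 /\ regular_semisimple_on g W.
Proof.
move=> mm sqm hm; have [p pm hp] := annihilator g v.
have /dvdpP[q qE] : m %| p by apply/hm/hp.
have p0 := monic_neq0 pm.
have q0 : q != 0 by apply: contraNneq p0 => q0; rewrite qE q0 mul0r.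
apply: (@cyclic_regular g (pact g v q) m) => //.
  by rewrite prednK // lt0n size_poly_eq0 monic_neq0.
move=> f; rewrite -pactM; split=> [/hp|mf]; first by rewrite qE dvdp_mul2l.
by apply/hp; rewrite qE dvdp_mul2l.
Qed.

End Cyclic.

(** * Invariants of a vector and an isometry *)

Section FormData.
Variables (F : finFieldType) (n : nat) (X : form_space F n.+1).
Local Notation V := 'rV[F]_n.+1.
Local Notation th := (fs_theta X).
Local Notation ep := (fs_eps X).
Local Notation B := (fs_B X).
Local Notation N := (fs_N X).
Local Notation in_rad := (in_rad X).
Local Notation isometric := (isometric X).
Implicit Types (v w x y : V) (g : 'M[F]_n.+1) (f p h m e : {poly F}).

Lemma isometricX g i : isometric g -> isometric (g ^+ i).
Proof.
move=> gI; elim: i => [|i IH]; first by rewrite expr0; exact: isometric1.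
by rewrite exprS; apply: isometricM.
Qed.

Lemma isometric_shift g v i j k : isometric g ->
  B (v *m g ^+ (i + k)) (v *m g ^+ (j + k)) = B (v *m g ^+ i) (v *m g ^+ j).
Proof.
move=> gI; have [h _] := isometricX k gI.
by rewrite !exprD -(h (v *m g ^+ i)) !mulmxA.
Qed.

(* f lies in the annihilator of v modulo the radical of F[g]v; the shifts by g^i
   make this visibly an ideal. *)
Definition corr0 g v f := forall i j, B (pact g v f *m g ^+ i) (v *m g ^+ j) = 0.

Lemma rad_corr0 g v f : isometric g -> in_rad (pact g v f) -> corr0 g v f.
Proof. by move=> gI h i j; apply: (iffRL (isometric_rad _ (isometricX i gI)) h). Qed.

Lemma corr0_mul g v f a : corr0 g v f -> corr0 g v (a * f).
Proof.
move=> h i j; rewrite mulrC pactM -(pactX g) -pactM pactE fs_B_suml.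
by apply: big1 => k _; rewrite fs_BZl h mulr0.
Qed.

Lemma corr0_gen g v : exists2 p, p \is monic & forall f, corr0 g v f <-> p %| f.
Proof.
apply: poly_ideal_gen.
- exists (char_poly g); first by rewrite monic_neq0 ?char_poly_monic.
  by move=> i j; rewrite pact_char mul0mx fs_B0l.
- by move=> f1 f2 h1 h2 i j; rewrite pactD mulmxDl fs_BDl h1 h2 addr0.
- by move=> f a; apply: corr0_mul.
Qed.

Lemma rad_gen g v : isometric g ->
  exists2 p, p \is monic & forall f, in_rad (pact g v f) <-> p %| f.
Proof.
move=> gI; apply: poly_ideal_gen.
- exists (char_poly g); first by rewrite monic_neq0 ?char_poly_monic.
  by move=> w; rewrite pact_char fs_B0l.
- by move=> f1 f2 h1 h2 w; rewrite pactD fs_BDl h1 h2 addr0.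
- move=> f a h w; rewrite mulrC pactM pactE fs_B_suml.
  apply: big1 => k _; rewrite fs_BZl.
  by rewrite (iffRL (isometric_rad _ (isometricX k gI)) h) mulr0.
Qed.

(** The adjoint of g is its inverse: hermitian symmetry turns a relation for f into one for
    theta(f)(1/x), and x^d clears the denominators. *)
Lemma corr0_srev g v d f : isometric g -> (size f <= d.+1)%N -> corr0 g v f ->
  corr0 g v (srev th d f).
Proof.
move=> gI sf h i j.
have gX k l : v *m g ^+ k *m g ^+ l = v *m g ^+ (k + l) by rewrite exprD mulmxA.
have -> : pact g v (srev th d f) = \sum_(k < d.+1) th f`_k *: (v *m g ^+ (d - k)).
  rewrite (srevE th sf) /pact rmorph_sum mulmx_sumr; apply: eq_bigr => k _ /=.
  by rewrite horner_mxZ -scalemxAr; congr (_ *: _); exact: pactX.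
transitivity (ep * th (B (pact g v f *m g ^+ j) (v *m g ^+ (i + d)))); last first.
  by rewrite h rmorph0 mulr0.
rewrite pactE !mulmx_suml !fs_B_suml rmorph_sum mulr_sumr.
rewrite [RHS](big_ord_widen d.+1
  (fun k => ep * th (B (f`_k *: (v *m g ^+ k) *m g ^+ j) (v *m g ^+ (i + d))))) //.
rewrite [RHS]big_mkcond /=.
apply: eq_bigr => k _; rewrite -!scalemxAl !fs_BZl !gX.
case: ifP => hk; last first.
  by rewrite nth_default ?rmorph0 ?mul0r // leqNgt hk.
rewrite rmorphM mulrCA -(fs_BC X); congr (_ * _).
have kd : (k <= d)%N by rewrite -ltnS.
rewrite -(@isometric_shift g v (d - k + i) j k) //; congr (B (v *m g ^+ _) (v *m g ^+ _)); lia.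
Qed.

(* h^2 m e annihilates v modulo the radical of V, and h^2 m annihilates v modulo
   the radical of F[g]v. *)
Definition fdata g v h m e : Prop :=
  [/\ [/\ h \is monic, m \is monic & e \is monic], squarefree_poly m,
      selfrecip th h /\ selfrecip th m,
      forall f, in_rad (pact g v f) <-> h ^+ 2 * m * e %| f &
      forall f, corr0 g v f <-> h ^+ 2 * m %| f].

Lemma exists_fdata g v : isometric g -> exists h m e, fdata g v h m e.
Proof.
move=> gI; have [p pm hp] := rad_gen v gI; have [u um hu] := corr0_gen g v.
have u0 := monic_neq0 um.
have [h [m [hm uE sqm]]] := max_square_divisor u0.
have mm : m \is monic by move: um; rewrite uE monicMl // rpredX.
have /dvdpP[e pE] : u %| p by apply/hu/rad_corr0/hp.
have em : e \is monic by move: pm; rewrite pE monicMr.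
exists h, m, e; split=> //; rewrite -?uE //; last by rewrite mulrC -pE.
apply: selfrecip_square_part => //; rewrite -uE.
have su : size u = (size u).-1.+1 by rewrite prednK // lt0n size_poly_eq0.
rewrite /selfrecip; set d := (size u).-1 in su *.
(* The reversal of u lies in the ideal generated by u, is nonzero (its constant term is 1) and is no
   larger than u, so it is associate to u. *)
have ur : u %| srev th d u.
  by apply/hu/corr0_srev; rewrite ?su //; apply/hu.
have r0 : srev th d u != 0.
  apply/eqP => /(congr1 (coefp 0)); rewrite /= coef_poly subn0 coef0.
  have := monicP um; rewrite lead_coefE -/d => ->.
  by move/eqP; rewrite rmorph1 oner_eq0.
rewrite eqp_sym -(dvdp_size_eqp ur) eqn_leq (dvdp_leq r0 ur) su.
exact: size_srev.
Qed.

Lemma size_mulm h m : h \is monic -> m \is monic ->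
  size (h * m) = ((size h).-1 + (size m).-1).+1.
Proof.
move=> hm mm; rewrite size_mul ?monic_neq0 //.
have : (0 < size h)%N by rewrite lt0n size_poly_eq0 monic_neq0.
have : (0 < size m)%N by rewrite lt0n size_poly_eq0 monic_neq0.
move: (size h) (size m) => a b; lia.
Qed.

(* The radical of F[g]v has dimension r modulo that of V and is orthogonal to
   F[g]v, whence r <= n + 1 - s with s = 2 k + b + r. *)
Lemma fdata_shape g v h m e k b r : isometric g -> fdata g v h m e ->
    size h = k.+1 -> size m = b.+1 -> size e = r.+1 ->
  (2 * k + b + r <= n.+1 /\ r <= n.+1 - (2 * k + b + r))%N.
Proof.
move=> gI [[hm mm em] sqm _ hp hu] sh sm se.
have h2m : h ^+ 2 \is monic by rewrite rpredX.
have su : size (h ^+ 2 * m) = (2 * k + b).+1.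
  by rewrite size_mulm // expr2 size_mulm // sh sm /=; lia.
have umn : h ^+ 2 * m \is monic by rewrite monicMl.
have sp : size (h ^+ 2 * m * e) = (2 * k + b + r).+1.
  by rewrite size_mulm // su se.
set s := (2 * k + b + r)%N in sp *; set u := h ^+ 2 * m in hp hu su sp umn.
have hp0 f : pact g v f = 0 -> u * e %| f by move=> h0; apply/hp; rewrite h0 => w; rewrite fs_B0l.
have Kf : row_free (krylov s g v) by apply: krylov_free hp0 sp.
have sD : (s <= n.+1)%N by rewrite -(eqP Kf) rank_leq_col.
split=> //.
(* The rows of Y lie in the radical of F[g]v; they are independent modulo the radical of V because u
   f is a multiple of u e only if e divides f. *)
pose Y := krylov r g (pact g v u).
have YK : Y *m gram X *m (map_mx th (krylov s g v))^T = 0.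
  apply/matrixP=> i j; rewrite [RHS]mxE.
  have := (iffRL (hu u) (dvdpp u)) i j; rewrite gramE => <-.
  by rewrite !mxE; apply: eq_bigr => l _; rewrite !mxE; congr (_ * _); apply: eq_bigr => l' _; rewrite !mxE.
have := mulmx0_rank_max YK.
rewrite mxrank_tr mxrank_map (eqP Kf) => rk.
suff Yf : row_free (Y *m gram X) by move: rk; rewrite (eqP Yf); lia.
rewrite -kermx_eq0; apply/eqP/row_matrixP=> i; rewrite row0.
set x := row i _; have : x *m (Y *m gram X) = 0 by apply/sub_kermxP; rewrite row_sub.
rewrite mulmxA => /in_radP; rewrite mul_krylov -pactM => /hp.
rewrite dvdp_mul2l ?monic_neq0 // => ex.
apply: (can_inj rVpolyK); rewrite linear0; apply: contraTeq ex => x0.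
by apply/negP=> /(dvdp_leq x0); rewrite se ltnNge size_rVpoly.
Qed.

Lemma fs_N_sum_eq (a a' : nat -> V) k : (forall i, N (a i) = N (a' i)) ->
  (forall i j, B (a i) (a j) = B (a' i) (a' j)) ->
  N (\sum_(i < k) a i) = N (\sum_(i < k) a' i).
Proof.
move=> hN hB; elim: k => [|k IH]; first by rewrite !big_ord0.
rewrite !big_ord_recr /= !fs_ND IH hN; congr (_ + fs_tau X _).
by rewrite !fs_B_suml; apply: eq_bigr => i _.
Qed.

(* The correlations c_i = B(v g^i, v) with |i| <= t/2 fill a window of length at
   least t, symmetric under i -> -i, so c_0, ..., c_(t/2) and the recurrence u
   determine all of them. *)
Lemma corr_eq g v g' v' u t : isometric g -> isometric g' ->
    u \is monic -> size u = t.+1 -> corr0 g v u -> corr0 g' v' u ->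
    (forall i, (i <= t./2)%N -> B (v *m g ^+ i) v = B (v' *m g' ^+ i) v') ->
  forall i j, B (v *m g ^+ i) (v *m g ^+ j) = B (v' *m g' ^+ i) (v' *m g' ^+ j).
Proof.
move=> gI gI' um su hu hu' e.
have sh k x i j : isometric k -> (j <= i)%N ->
    B (x *m k ^+ i) (x *m k ^+ j) = B (x *m k ^+ (i - j)) x.
  by move=> kI ji; have := isometric_shift x (i - j) 0 j kI; rewrite subnK // add0n expr0 mulmx1.
have recur k x i l : isometric k -> corr0 k x u ->
    B (x *m k ^+ (t + i)) (x *m k ^+ l) =
    - \sum_(j < t) u`_j * B (x *m k ^+ (j + i)) (x *m k ^+ l).
  move=> kI /(_ i l); rewrite pactE su mulmx_suml fs_B_suml big_ord_recr /=.
  have -> : u`_t = 1 by have := monicP um; rewrite lead_coefE su.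
  rewrite scale1r -mulmxA -[_ *m k ^+ i]exprD => /eqP; rewrite addrC addr_eq0 => /eqP ->.
  congr (- _); apply: eq_bigr => j _.
  by rewrite -scalemxAl fs_BZl exprD mulmxA.
have c0 i : B (v *m g ^+ i) v = B (v' *m g' ^+ i) v'.
  elim/ltn_ind: i => i IH; have [it|ti] := leqP i t./2; first exact: e.
  set l := t./2 in ti; have tl : (t - l <= i)%N by have := odd_double_half t; rewrite /l in ti *; lia.
  have lt : (l <= t)%N by rewrite /l; have := odd_double_half t; lia.
  (* After a shift by l, the recurrence expresses c_i through c_(i-t), ..., c_(i-1); the negative
     indices are at least -l and are reflected by symmetry of B. *)
  pose i0 := (i - (t - l))%N.
  have iE : (i + l = t + i0)%N by rewrite /i0; lia.
  have top k x : isometric k -> B (x *m k ^+ i) x = B (x *m k ^+ (t + i0)) (x *m k ^+ l).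
    by move=> kI; rewrite -iE sh ?leq_addl // addnK.
  rewrite !top // !recur //; congr (- _); apply: eq_bigr => j _; congr (_ * _).
  have jt := ltn_ord j; have [lj|jl] := leqP l (j + i0).
    by rewrite !sh //; apply: IH; lia.
  rewrite (fs_BC X) [RHS](fs_BC X) !sh ?(ltnW jl) // IH //; lia.
move=> i j; have [ji|ij] := leqP j i; first by rewrite !sh // c0.
by rewrite (fs_BC X) [RHS](fs_BC X) !sh ?(ltnW ij) // c0.
Qed.

(** Equal correlations and N give Krylov matrices with the same form values, and the common ideal of
    h^2 m e matches their radicals, so [witt] applies. Taking a b rows, for a and b exponents that
    kill g and g', captures both orbits entirely. *)
Lemma fdata_equiv g v g' v' h m e : isometric g -> isometric g' ->
    fdata g v h m e -> fdata g' v' h m e -> N v = N v' ->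
    (forall i, (i <= (size (h ^+ 2 * m)%R).-1./2)%N ->
       B (v *m g ^+ i) v = B (v' *m g' ^+ i) v') ->
  exists2 k, isometric k & forall i, v *m g ^+ i *m k = v' *m g' ^+ i.
Proof.
move=> gI gI' [[hm mm em] _ _ hp hu] [_ _ _ hp' hu'] eN eB.
have umn : h ^+ 2 * m \is monic by rewrite monicMl ?rpredX.
have su : size (h ^+ 2 * m) = (size (h ^+ 2 * m)).-1.+1.
  by rewrite prednK // lt0n size_poly_eq0 monic_neq0.
have eD := corr_eq gI gI' umn su (iffRL (hu _) (dvdpp _)) (iffRL (hu' _) (dvdpp _)) eB.
have eNi i : N (v *m g ^+ i) = N (v' *m g' ^+ i).
  by have [_ ->] := isometricX i gI; have [_ ->] := isometricX i gI'.
have [a a0 ga] := unitmx_torsion (isometric_unit gI).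
have [b b0 gb] := unitmx_torsion (isometric_unit gI').
have [|||k [kI kE]] := @witt F n.+1 X (a * b) (krylov (a * b) g v) (krylov (a * b) g' v').
- move=> x y; rewrite !mul_krylov !pactE !fs_B_suml; apply: eq_bigr => i _.
  by rewrite !fs_B_sumr; apply: eq_bigr => j _; rewrite !fs_BZl !fs_BZr eD.
- move=> x; rewrite !mul_krylov !pactE.
  apply: (@fs_N_sum_eq (fun i => (rVpoly x)`_i *: (v *m g ^+ i))
                    (fun i => (rVpoly x)`_i *: (v' *m g' ^+ i))) => [i|i j].
    by rewrite !fs_NZ eNi.
  by rewrite !fs_BZl !fs_BZr eD.
- by move=> x; rewrite !mul_krylov; split=> [/hp/hp'|/hp'/hp].
exists k => // i; have ab0 : (0 < a * b)%N by rewrite muln_gt0 a0.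
have e1 : g ^+ (a * b) = 1 by rewrite exprM ga expr1n.
have e2 : g' ^+ (a * b) = 1 by rewrite mulnC exprM gb expr1n.
rewrite -(expr_mod i e1) -(expr_mod i e2).
have := congr1 (row (Ordinal (ltn_pmod i ab0))) kE.
by rewrite row_mul !rowK.
Qed.

Definition data_class k b r (G : {set 'M[F]_n.+1}) : {set V * 'M[F]_n.+1} :=
  [set x | (x.2 \in G) && `[< exists h m e, [/\ fdata x.2 x.1 h m e,
     size h = k.+1, size m = b.+1 & size e = r.+1] >]].

Definition coef_code (k : nat) f : {ffun 'I_k -> F} := [ffun i : 'I_k => f`_i].

Lemma monic_code_inj k (p q : {poly F}) :
  p \is monic -> q \is monic -> size p = k.+1 -> size q = k.+1 ->
  coef_code k p = coef_code k q -> p = q.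
Proof.
move=> pm qm sp sq E; apply/polyP=> i; have [ir|] := ltnP i k.
  by have /ffunP/(_ (Ordinal ir)) := E; rewrite !ffunE.
rewrite leq_eqVlt => /predU1P[<-|ri]; last by rewrite !nth_default ?sp ?sq.
by have := monicP pm; have := monicP qm; rewrite !lead_coefE sp sq /= => -> ->.
Qed.

(** The code consists of half the coefficients of h and m, all of e, the correlations up to t/2, and
    N v. That is k/2 + b/2 + r + t/2 + 4 parameters with halves rounded down, at most 2k + b + r + 4
    minus [uphalf k]; each fibre has at most |G| elements by [card_fibre]. *)
Lemma card_data_class (G : {set 'M[F]_n.+1}) k b r :
    (forall g, g \in G <-> isometric g) ->
  (#|data_class k b r G| * #|F| ^ uphalf k <= #|G| * #|F| ^ (2 * k + b + r + 4))%N.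
Proof.
move=> GP; set t := (2 * k + b)%N.
pose C := ({ffun 'I_(k./2.+1) -> F} * {ffun 'I_(b./2.+1) -> F} * {ffun 'I_r -> F}
  * {ffun 'I_(t./2.+1) -> F} * F)%type.
pose code (x : V * 'M[F]_n.+1) (c : C) := exists h m e,
  [/\ [/\ fdata x.2 x.1 h m e, size h = k.+1, size m = b.+1 & size e = r.+1] &
   c = (coef_code _ h, coef_code _ m, coef_code _ e,
        [ffun i : 'I__ => B (x.1 *m x.2 ^+ i) x.1], N x.1)].
have : (#|data_class k b r G| <= #|{: C}| * #|G|)%N.
  apply: (card_codes (code := code)) => [x|c].
    rewrite inE => /andP[_ /asboolP[h [m [e hd]]]].
    by exists (coef_code _ h, coef_code _ m, coef_code _ e,
        [ffun i : 'I__ => B (x.1 *m x.2 ^+ i) x.1], N x.1); exists h, m, e.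
  apply: card_fibre.
  - by move=> g /GP; apply: isometric_unit.
  - by move=> g h /GP gI /GP hI; apply/GP/isometricM.
  - move=> g /GP gI; apply/GP; have gU := isometric_unit gI; case: gI => gB gN.
    by split=> [x y|x]; [rewrite -gB !mulmxKV | rewrite -gN mulmxKV].
  - by move=> x; rewrite !inE => /andP[/andP[]].
  move=> x y; rewrite !inE => /andP[/andP[/GP xI _] /asboolP[h [m [e [[hd sh sm se] cE]]]]].
  move=> /andP[/andP[/GP yI _] /asboolP[h' [m' [e' [[hd' sh' sm' se'] cE']]]]].
  have coefE j p q : coef_code j p = coef_code j q -> forall i, (i < j)%N -> p`_i = q`_i.
    by move=> E i ij; have /ffunP/(_ (Ordinal ij)) := E; rewrite !ffunE.
  have := cE'; rewrite cE => -[eh em ee eB eN].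
  have [[hmo mmo emo] _ [hsr msr] _ _] := hd.
  have [[hmo' mmo' emo'] _ [hsr' msr'] _ _] := hd'.
  have hh : h = h' by apply: (selfrecip_inj hmo hmo' sh sh' hsr hsr') => i ik; exact: (coefE _ _ _ eh).
  have mm : m = m' by apply: (selfrecip_inj mmo mmo' sm sm' msr msr') => i ik; exact: (coefE _ _ _ em).
  have e_e := monic_code_inj emo emo' se se' ee.
  subst h' m' e'.
  have [|K KI KE] := fdata_equiv xI yI hd hd' eN; last first.
    by exists K => //; apply/GP.
  have -> : (size (h ^+ 2 * m)%R).-1 = t.
    by rewrite size_mulm ?rpredX // expr2 size_mulm // sh sm /= /t; lia.
  move=> i it; have it1 : (i < t./2.+1)%N by [].
  by have /ffunP/(_ (Ordinal it1)) := eB; rewrite !ffunE.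
move=> le1; apply: leq_trans (leq_mul le1 (leqnn _)) _.
rewrite mulnAC mulnC leq_mul2l; apply/orP; right.
rewrite !card_prod !card_ffun !card_ord -!expnD -[X in (_ * X * _)%N]expn1.
rewrite -!expnD leq_exp2l; last exact: card_finRing_gt1.
have -> : t./2 = (k + b./2)%N by rewrite /t mul2n halfD odd_double doubleK.
have := odd_double_half b; have := uphalf_half k; have := odd_double_half k; lia.
Qed.
End FormData.

(** * Profiles *)

(* k and b are the degrees of h and m, and r is the dimension of the radical. *)
Definition profile_cover (F : finFieldType) n (G : {set 'M[F]_n.+1})
    (Om : nat -> nat -> nat -> {set 'rV[F]_n.+1 * 'M[F]_n.+1}) :=
  [/\ forall v g, g \in G -> exists k b r, (v, g) \in Om k b r,
      forall k b r x, x \in Om k b r ->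
        (2 * k + b + r <= n.+1)%N /\ (r <= n.+1 - (2 * k + b + r))%N,
      forall k b r, (#|Om k b r| * #|F| ^ uphalf k
                     <= #|G| * #|F| ^ (2 * k + b + r + 4))%N &
      forall k b r x, x \in Om k b r ->
        exists W : 'M[F]_n.+1, \rank W = b /\ regular_semisimple_on x.2 W].

Lemma form_cover (F : finFieldType) n (X : form_space F n.+1) (G : {set 'M[F]_n.+1}) :
  (forall g, g \in G <-> isometric X g) ->
  profile_cover G (fun k b r => data_class X k b r G).
Proof.
move=> GP; split.
- move=> v g gG; have gI := iffLR (GP g) gG.
  have [h [m [e hd]]] := exists_fdata v gI.
  have [[hm mm em] _ _ _ _] := hd.
  exists (size h).-1, (size m).-1, (size e).-1; rewrite inE gG; apply/asboolP.
  by exists h, m, e; split; rewrite ?prednK // lt0n size_poly_eq0 monic_neq0.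
- move=> k b r x; rewrite inE => /andP[/GP gI /asboolP[h [m [e [hd sh sm se]]]]].
  exact: fdata_shape gI hd sh sm se.
- by move=> k b r; apply: card_data_class.
- move=> k b r x; rewrite inE => /andP[/GP gI /asboolP[h [m [e [hd sh sm se]]]]].
  have [[hm mm em] sqm _ _ hu] := hd.
  have [f f0|W [rW Wr]] := exists_regular mm sqm (g := x.2) (v := x.1).
    have /hu : corr0 X x.2 x.1 f by move=> i j; rewrite f0 mul0mx fs_B0l.
    by apply: dvdp_trans; rewrite dvdp_mull.
  by exists W; rewrite rW sm.
Qed.

(** * Profiles for the general linear group *)

Section GeneralLinear.
Variables (F : finFieldType) (n : nat).
Local Notation V := 'rV[F]_n.+1.
Implicit Types (v : V) (g : 'M[F]_n.+1) (h m p : {poly F}).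

(** The analogue of Witt's theorem without a form: equal relations among the rows make A -> A' well
    defined and rank-preserving, so it extends to an invertible map. *)
Lemma unitmx_extend k d (A A' : 'M[F]_(k, d)) :
  (forall x : 'rV_k, x *m A = 0 <-> x *m A' = 0) ->
  exists2 g, g \in unitmx & A *m g = A'.
Proof.
move=> eA.
have ext (C C' : 'M[F]_(k, d)) : (forall x : 'rV_k, x *m C = 0 -> x *m C' = 0) ->
    C *m (pinvmx C *m C') = C'.
  move=> hC; apply/row_matrixP=> i; apply/eqP; rewrite -subr_eq0 -linearB /=.
  rewrite rowE -subr_eq0 subr0.
  have -> : C *m (pinvmx C *m C') - C' = (C *m pinvmx C - 1%:M) *m C'.
    by rewrite mulmxBl mul1mx mulmxA.
  by rewrite mulmxA; apply/eqP/hC; rewrite -mulmxA mulmxBl mul1mx mulmxKpV // subrr mulmx0.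
have e1 : A *m (pinvmx A *m A') = A' by apply: ext => x /eA.
have e2 : A' *m (pinvmx A' *m A) = A by apply: ext => x /eA.
have [|g gU gE] := @complete_unitmx _ _ _ A (pinvmx A *m A').
  have := mxrankM_maxl A (pinvmx A *m A'); have := mxrankM_maxl A' (pinvmx A' *m A).
  by rewrite e1 e2 => l1 l2; apply/eqP; rewrite eqn_leq l1 l2.
by exists g => //; rewrite -gE.
Qed.

(** With no form there is no radical, so only r = 0 occurs. *)
Definition gl_class k b r : {set V * 'M[F]_n.+1} :=
  [set x | [&& x.2 \in general_linear F n.+1, r == 0%N & `[< exists h m,
     [/\ [/\ h \is monic, m \is monic & squarefree_poly m],
         forall f, pact x.2 x.1 f = 0 <-> h ^+ 2 * m %| f,
         size h = k.+1 & size m = b.+1] >]]].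

Lemma gl_equiv g v g' v' p : g \in unitmx -> g' \in unitmx ->
    (forall f, pact g v f = 0 <-> p %| f) -> (forall f, pact g' v' f = 0 <-> p %| f) ->
  exists2 t, t \in unitmx & forall i, v *m g ^+ i *m t = v' *m g' ^+ i.
Proof.
move=> gU gU' hp hp'.
have [a a0 ga] := unitmx_torsion gU.
have [b b0 gb] := unitmx_torsion gU'.
have [x|t tU tE] := @unitmx_extend _ _ (krylov (a * b) g v) (krylov (a * b) g' v').
  by rewrite !mul_krylov; split=> [/hp/hp'|/hp'/hp].
exists t => // i; have ab0 : (0 < a * b)%N by rewrite muln_gt0 a0.
have e1 : g ^+ (a * b) = 1 by rewrite exprM ga expr1n.
have e2 : g' ^+ (a * b) = 1 by rewrite mulnC exprM gb expr1n.
rewrite -(expr_mod i e1) -(expr_mod i e2).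
have := congr1 (row (Ordinal (ltn_pmod i ab0))) tE.
by rewrite row_mul !rowK.
Qed.

Lemma gl_cover : profile_cover (general_linear F n.+1) gl_class.
Proof.
split.
- move=> v g gG; have [p pm hp] := annihilator g v.
  have [h [m [hm pE sqm]]] := max_square_divisor (monic_neq0 pm).
  have mm : m \is monic by move: pm; rewrite pE monicMl // rpredX.
  exists (size h).-1, (size m).-1, 0%N; rewrite inE gG /=; apply/asboolP.
  by exists h, m; rewrite -pE; split=> //; rewrite prednK // lt0n size_poly_eq0 monic_neq0.
- move=> k b r x; rewrite inE => /and3P[_ /eqP -> /asboolP[h [m [[hm mm sqm] hp sh sm]]]].
  suff : (2 * k + b <= n.+1)%N by lia.
  have sp : size (h ^+ 2 * m) = (2 * k + b).+1.
    by rewrite size_mulm ?rpredX // expr2 size_mulm // sh sm /=; lia.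
  have := krylov_free (fun f => iffLR (hp f)) sp.
  by move=> /eqP <-; exact: rank_leq_col.
- move=> k b r.
  pose C := ({ffun 'I_k -> F} * {ffun 'I_b -> F})%type.
  pose code (x : V * 'M[F]_n.+1) (c : C) := exists h m,
    [/\ [/\ h \is monic, m \is monic & squarefree_poly m],
         forall f, pact x.2 x.1 f = 0 <-> h ^+ 2 * m %| f,
         size h = k.+1 /\ size m = b.+1 & c = (coef_code _ h, coef_code _ m)].
  have : (#|gl_class k b r| <= #|{: C}| * #|general_linear F n.+1|)%N.
    apply: (card_codes (code := code)) => [x|c].
      rewrite inE => /and3P[_ _ /asboolP[h [m [hm hp sh sm]]]].
      by exists (coef_code _ h, coef_code _ m); exists h, m.
    apply: card_fibre.
    - by move=> g; rewrite inE.
    - by move=> g g'; rewrite !inE => gU gU'; rewrite unitmx_mul gU.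
    - by move=> g; rewrite !inE unitmx_inv.
    - by move=> x; rewrite inE => /andP[]; rewrite inE => /and3P[].
    move=> x y; rewrite !inE.
    move=> /andP[/and3P[xU _ _] /asboolP[h [m [[hm mm sqm] hp [sh sm] cE]]]].
    move=> /andP[/and3P[yU _ _] /asboolP[h' [m' [[hm' mm' sqm'] hp' [sh' sm'] cE']]]].
    have := cE'; rewrite cE => -[eh em].
    have hh := monic_code_inj hm hm' sh sh' eh.
    have mm_ := monic_code_inj mm mm' sm sm' em; subst h' m'.
    have [t tU tE] := gl_equiv xU yU hp hp'.
    by exists t => //; rewrite inE.
  move=> le1; apply: leq_trans (leq_mul le1 (leqnn _)) _.
  rewrite mulnAC mulnC leq_mul2l; apply/orP; right.
  rewrite card_prod !card_ffun !card_ord -!expnD leq_exp2l; last exact: card_finRing_gt1.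
  have := uphalf_half k; have := odd_double_half k; lia.
- move=> k b r x; rewrite inE => /and3P[_ _ /asboolP[h [m [[hm mm sqm] hp sh sm]]]].
  have [f /hp|W [rW Wr]] := exists_regular mm sqm (g := x.2) (v := x.1).
    by apply: dvdp_trans; rewrite dvdp_mull.
  by exists W; rewrite rW sm.
Qed.
End GeneralLinear.

(** * The classical groups *)

Lemma nondegenerate_in_rad0 (F : fieldType) eps (theta : {rmorphism F -> F}) d
    (f : {hermitian 'rV[F]_d for eps & theta}) r :
  nondegenerate f -> (forall w, f r w = 0) -> r = 0.
Proof.
move=> /eqP nd hr; apply/eqP; rewrite -memv0 -nd.
by apply/mem_orthovP => v _; apply: hr.
Qed.

Lemma symplectic_cover (F : finFieldType) n (f : {skew_symmetric 'rV[F]_n.+1}) :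
  is_psymplectic f -> exists Om, profile_cover (isometry_group f) Om.
Proof.
move=> [nd _ alt2].
have fC u v : f u v = - f v u by rewrite hermitian_subproof expr1 mulN1r.
(* Skew-symmetry suffices unless 2 = 0, where alternation is part of [is_psymplectic]. It provides
   [fs_even] with k = 0. *)
have alt u : f u u = 0.
  have [c2|c2] := boolP (2 \in [pchar F]); first exact: alt2.
  have : f u u + f u u = 0 by rewrite {1}fC addNr.
  rewrite -mulr2n -mulr_natl => /eqP; rewrite mulf_eq0 => /orP[c|/eqP //].
  by case/negP: c2; rewrite inE /= c.
have X : {X : form_space F n.+1 | fs_B X = f /\ fs_N X = (fun=> 0)}.
  unshelve eexists (@FormSpace F n.+1 idfun (-1) f (fun=> 0) (fun=> 0) _ _ _ _ _ _ _ _ _ _ _ _).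
  - by [].
  - by rewrite mulrNN mulr1.
  - by rewrite rmorphN1.
  - by move=> a u v w; rewrite linearPl.
  - by move=> u v; rewrite fC mulN1r.
  - by move=> a u; rewrite mulr0.
  - by move=> u v; rewrite !addr0.
  - by move=> x y; rewrite addr0.
  - by move=> a x; rewrite mulr0.
  - by [].
  - by move=> u; exists 0; rewrite alt rmorph0 mulr0 addr0.
  - by move=> r hr _; apply: nondegenerate_in_rad0 hr.
  by [].
have [{}X [XB XN]] := X.
exists (fun k b r => data_class X k b r (isometry_group f)); apply: form_cover => g.
rewrite inE /isometric XB XN; split=> [/andP[_ /forallP h]|gI].
  by split=> // x y; apply/eqP; move: (h x) => /forallP.
apply/andP; split; first by apply: (@isometric_unit _ _ X); rewrite /isometric XB XN.
by case: gI => h _; apply/forallP=> x; apply/forallP=> y; rewrite h.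
Qed.

Lemma unitary_cover (F : finFieldType) n q (theta : {rmorphism F -> F})
    (f : {hermitian_sym 'rV[F]_n.+1 for theta}) :
  #|F| = (q ^ 2)%N -> (forall x, theta x = x ^+ q) -> is_unitary f ->
  exists Om, profile_cover (isometry_group f) Om.
Proof.
move=> cF tE [nd _].
have thK : involutive theta by move=> x; rewrite !tE -exprM mulnn -cF expf_card.
have fC u v : f u v = theta (f v u) by rewrite hermitian_subproof expr0 mul1r.
have q1 : (1 < q)%N.
  have := card_finRing_gt1 F; rewrite cF; by case: (q) => [|[|]].
(* If all traces vanished, theta would be -id, and theta 1 = 1 would force it to be the identity;
   then X^q - X would have q^2 roots. *)
have [a ha] : exists a, a + theta a != 0.
  apply/existsP; rewrite -[X in is_true X]negbK negb_exists; apply/negP=> /forallP tr0.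
  have tN x : theta x = - x.
    by have := tr0 x; rewrite negbK addrC addr_eq0 => /eqP.
  have tid (x : F) : x ^+ q = x.
    have := tN 1; rewrite rmorph1 => e1.
    by rewrite -tE tN -mulN1r -e1 mul1r.
  pose P : {poly F} := 'X^q - 'X.
  have sP : size P = q.+1 by rewrite size_polyDl ?size_polyXn // size_polyN size_polyX ltnS.
  have P0 : P != 0 by rewrite -size_poly_eq0 sP.
  have rP : all (root P) (enum F).
    by apply/allP=> x _; rewrite rootE !hornerE tid subrr.
  have := max_poly_roots P0 rP (enum_uniq F).
  by rewrite -cardE cF sP ltnS; nia.
(* Surjectivity of the trace onto fixed elements, as [fs_even] requires for f u u. *)
have tra c : theta c = c -> exists k, c = k + theta k.
  move=> tc; exists (c / (a + theta a) * a).
  rewrite !rmorphM fmorphV rmorphD thK tc [theta a + a]addrC -mulrDr.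
  by rewrite divfK.
have X : {X : form_space F n.+1 | fs_B X = f /\ fs_N X = (fun u => f u u)}.
  unshelve eexists (@FormSpace F n.+1 theta 1 f (fun u => f u u)
    (fun x => x + theta x) _ _ _ _ _ _ _ _ _ _ _ _).
  - by [].
  - by rewrite mulr1.
  - by rewrite rmorph1.
  - by move=> b u v w; rewrite linearPl.
  - by move=> u v; rewrite mul1r.
  - by move=> b u /=; rewrite linearZl_LR linearZr_LR /= mulrA.
  - move=> u v /=; have -> : f (u + v) (u + v) = f u u + f u v + (f v u + f v v).
      by rewrite linearDl !linearDr.
    by rewrite (fC v u); ring.
  - by move=> x y /=; rewrite rmorphD addrACA.
  - by move=> b x /=; rewrite !rmorphM thK; ring.
  - by move=> x /=; rewrite mul1r thK addrC.
  - move=> u; have [|k hk] := tra (f u u); first by rewrite -fC.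
    by exists k; rewrite mul1r.
  - by move=> r hr _; apply: nondegenerate_in_rad0 hr.
  by [].
have [{}X [XB XN]] := X.
exists (fun k b r => data_class X k b r (isometry_group f)); apply: form_cover => g.
rewrite inE /isometric XB XN; split=> [/andP[_ /forallP h]|gI].
  by split=> [x y|x]; apply/eqP; [move: (h x) | move: (h x)] => /forallP.
apply/andP; split; first by apply: (@isometric_unit _ _ X); rewrite /isometric XB XN.
by case: gI => h _; apply/forallP=> x; apply/forallP=> y; rewrite h.
Qed.

Lemma orthogonal_cover (F : finFieldType) n (Q : 'rV[F]_n.+1 -> F) :
  quadratic_form Q -> nondegenerate_quadratic Q ->
  exists Om, profile_cover (orthogonal_group Q) Om.
Proof.
move=> [QZ Qlin] nd.
have QD u v : Q (u + v) = Q u + Q v + polar Q u v by rewrite /polar; ring.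
have polarC u v : polar Q u v = polar Q v u by rewrite /polar (addrC u v); ring.
have X : {X : form_space F n.+1 | fs_B X = polar Q /\ fs_N X = Q}.
  unshelve eexists (@FormSpace F n.+1 idfun 1 (polar Q) Q id _ _ _ _ _ _ _ _ _ _ _ _).
  - by [].
  - by rewrite mulr1.
  - by rewrite rmorph1.
  - by move=> b u v w; rewrite !(polarC _ w) Qlin.
  - by move=> u v; rewrite mul1r polarC.
  - by move=> b u; rewrite QZ expr2.
  - exact: QD.
  - by [].
  - by [].
  - by move=> x; rewrite mul1r.
  - move=> u; exists (Q u); split=> //; rewrite mul1r /polar.
    by rewrite -mulr2n -scaler_nat QZ /=; ring.
  - by move=> r hr; apply: nd.
  by [].
have [{}X [XB XN]] := X.
exists (fun k b r => data_class X k b r (orthogonal_group Q)); apply: form_cover => g.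
rewrite inE /isometric XB XN; split=> [/andP[_ /forallP h]|gI].
  have {}h x : Q (x *m g) = Q x by apply/eqP.
  by split=> // x y; rewrite /polar -mulmxDl !h.
apply/andP; split; first by apply: (@isometric_unit _ _ X); rewrite /isometric XB XN.
by case: gI => _ h; apply/forallP=> x; rewrite h.
Qed.

(** * The tail estimate *)

(** Each term is f(a) x^a - f(a+1) x^(a+1), and the final remainder is nonnegative. *)
Lemma telescope_bound (R : realFieldType) (x : R) (w f : nat -> R) M :
  0 <= x -> (forall a, 0 <= f a) -> (forall a, w a = f a - x * f a.+1) ->
  \sum_(a < M) w a * x ^+ a <= f 0%N.
Proof.
move=> x0 f0 wE.
suff -> : \sum_(a < M) w a * x ^+ a = f 0%N - f M * x ^+ M.
  by rewrite gerBl mulr_ge0 ?exprn_ge0.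
elim: M => [|M IH]; first by rewrite big_ord0 expr0 mulr1 subrr.
by rewrite big_ord_recr /= IH wE exprS; ring.
Qed.

Lemma cube_sum_bound (R : realFieldType) M :
  \sum_(a < M) (a.+1)%:R ^+ 3 * (1 / 2) ^+ a <= 52 :> R.
Proof.
(* f a / 2^a is a discrete antiderivative of the summand. *)
pose f (a : nat) : R := 2 * a%:R ^+ 3 + 12 * a%:R ^+ 2 + 36 * a%:R + 52.
have -> : 52 = f 0%N by rewrite /f; ring.
apply: (telescope_bound (w := fun a : nat => (a.+1)%:R ^+ 3) (f := f)); first by lra.
  move=> a; have a0 : 0 <= a%:R :> R by [].
  by rewrite /f !addr_ge0 ?mulr_ge0 ?exprn_ge0 //.
by move=> a; rewrite /f -natr1; field.
Qed.

Lemma square_sum_bound (R : realFieldType) M :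
  \sum_(a < M) (a.+1)%:R ^+ 2 * (3 / 4) ^+ a <= 112 :> R.
Proof.
pose f (a : nat) : R := 4 * a%:R ^+ 2 + 32 * a%:R + 112.
have -> : 112 = f 0%N by rewrite /f; ring.
apply: (telescope_bound (w := fun a : nat => (a.+1)%:R ^+ 2) (f := f)); first by lra.
  move=> a; have a0 : 0 <= a%:R :> R by [].
  by rewrite /f !addr_ge0 ?mulr_ge0 ?exprn_ge0 //.
by move=> a; rewrite /f -natr1; field.
Qed.

(** Induction in steps of two, as 1/2 <= (3/4)^2 = 9/16. *)
Lemma half_uphalf_bound (R : realFieldType) k : (1 / 2) ^+ uphalf k <= (3 / 4) ^+ k :> R.
Proof.
elim/ltn_ind: k => -[|[|k]] IH; rewrite ?expr0 ?expr1 //; first by lra.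
rewrite /= exprS (exprS _ k.+1) (exprS _ k) mulrA.
apply: ler_pM => //; rewrite ?exprn_ge0 //; try lra.
exact: IH.
Qed.

(** After cancelling q^4, the exponent of q is j = a + [uphalf k] - 4, nonnegative because a + k >
    8; so q may be lowered to 2, and 16 = 2^4 restores the shift. *)
Lemma weight_bound (A g q d k a s : nat) :
  (1 < q)%N -> (8 < a + k)%N -> (s + a = d)%N ->
  (A * q ^ uphalf k <= g * q ^ (s + 4))%N ->
  (A * 2 ^ (a + uphalf k) <= 16 * (g * q ^ d))%N.
Proof.
move=> q1 ak sd le.
have au : (4 <= a + uphalf k)%N.
  by have := uphalf_half k; have := odd_double_half k; clear -ak; lia.
rewrite -(subnKC au); set j := (a + uphalf k - 4)%N.
have jE : (j + 4 = uphalf k + a)%N by rewrite subnK // addnC.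
rewrite expnD mulnCA leq_mul //.
apply: (@leq_trans (A * q ^ j)); first by rewrite leq_mul //; case: (j) => // i; rewrite leq_exp2r.
rewrite -(@leq_pmul2r (q ^ 4)) ?expn_gt0 ?(ltnW q1) //.
rewrite -!mulnA -!expnD jE -sd [(s + a + 4)%N]addnAC.
by rewrite (expnD q (uphalf k)) (expnD q (s + 4)) !mulnA leq_mul.
Qed.

(* The index a is the codimension of F[g]v, so l <= a and the codimension of W is
   a + l + 2 k <= 2 (a + k). The constant 16 makes the weight q^(4 - a - k/2)
   decreasing in q. *)
Lemma cover_bound (R : realType) (F : finFieldType) n (G : {set 'M[F]_n.+1}) Om :
  1 \in G -> profile_cover G Om -> forall r : R, 0 < r ->
  1 - 64 * 52 * 112 / r ^+ 2 <= uniform_prob R G (fun g : 'M[F]_n.+1 =>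
    exists W : 'M[F]_n.+1,
      (n.+1 - \rank W)%:R <= 16 + r /\ regular_semisimple_on g W).
Proof.
move=> G1 [cov shape card reg] r r0; set P := fun g => _.
set D := n.+1; set Q := #|F|.
have Q2 : (1 < Q)%N by exact: card_finRing_gt1.
have G0 : (0 < #|G|)%N by apply/card_gt0P; exists 1.
pose bad := [set g in G | ~~ `[< P g >]].
(* Profiles of bad pairs, reindexed with b = D - (2k + l + a); the guard keeps this subtraction from
   being truncated. *)
pose S k a l := [set y in Om k (D - (2 * k + l + a))%N l |
  (y.2 \in bad) && (2 * k + l + a <= D)%N].
pose w k a l : R :=
  if (l <= a)%N then k.+1%:R ^+ 2 * (3 / 4) ^+ k * (a.+1%:R ^+ 2 * (1 / 2) ^+ a) else 0.
pose T : R := #|G|%:R * Q%:R ^+ D.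
have T0 : 0 < T by rewrite mulr_gt0 ?exprn_gt0 ?ltr0n // ltnW.
have Sle k a l : #|S k a l|%:R <= T * (64 / r ^+ 2) * w k a l.
  have w0 : 0 <= w k a l.
    by rewrite /w; case: ifP => // _; rewrite !mulr_ge0 ?exprn_ge0 ?divr_ge0.
  have C0 : 0 <= T * (64 / r ^+ 2) by rewrite mulr_ge0 ?divr_ge0 ?exprn_ge0 // ltW.
  have [->|[y yS]] := set_0Vmem (S k a l); first by rewrite cards0 mulr_ge0.
  move: (yS); rewrite inE => /and3P[yO yb le].
  have [_ la] := shape _ _ _ _ yO; rewrite -/D in la.
  have {}la : (l <= a)%N by move: la le; clear; move: D => d; lia.
  have [W [rW Wr]] := reg _ _ _ _ yO.
  (* A bad g has no suitable W, so the codimension D - b <= 2(a + k) must exceed 16 + r; in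
     particular a + k > 8. *)
  have big : 16 + r < (2 * (a + k))%:R.
    rewrite ltNge; apply/negP=> h; move: yb; rewrite inE => /andP[_ /asboolPn]; apply.
    exists W; split=> //; apply: le_trans h; rewrite ler_nat rW -/D.
    by move: la le; clear; move: D => d; lia.
  have ak8 : (8 < a + k)%N.
    rewrite -(ltr_nat R); move: big; rewrite natrM; move: ((a + k)%:R : R) => x.
    by move: r0; clear; lra.
  have c1 : (#|S k a l| * 2 ^ (a + uphalf k) <= 16 * (#|G| * Q ^ D))%N.
    apply: (@weight_bound _ _ _ _ _ _ (D - a)) => //.
      by move: le; clear; move: D => d; lia.
    have -> : (D - a + 4 = 2 * k + (D - (2 * k + l + a)) + l + 4)%N.
      by move: le; clear; move: D => d; lia.
    apply: leq_trans (card _ _ _); rewrite leq_mul //.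
    by apply/subset_leq_card/subsetP=> z; rewrite inE => /andP[].
  have c2 : #|S k a l|%:R <= 16 * T * (1 / 2) ^+ (a + uphalf k).
    rewrite expr_div_n expr1n mulrA mulr1 ler_pdivlMr ?exprn_gt0 //.
    by move: c1; rewrite -(ler_nat R) !natrM !natrX.
  (* The Chebyshev factor: r < 2(a + k) <= 2(a + 1)(k + 1). Together with the 16 of [weight_bound]
     it gives 64 = 16 * 4. *)
  have c3 : 1 <= 4 * (a.+1%:R ^+ 2 * k.+1%:R ^+ 2) / r ^+ 2.
    rewrite ler_pdivlMr ?exprn_gt0 // mul1r.
    have h1 : r <= 2 * (a.+1%:R * k.+1%:R).
      apply: (@le_trans _ _ (2 * (a + k)%:R)).
        by move: big; rewrite natrM; move: ((a + k)%:R : R) => x; clear; lra.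
      by rewrite ler_pM2l // -natrM ler_nat; clear; nia.
    have -> : 4 * (a.+1%:R ^+ 2 * k.+1%:R ^+ 2) = (2 * (a.+1%:R * k.+1%:R)) ^+ 2 :> R by ring.
    by rewrite ler_sqr ?nnegrE ?(ltW r0) // !mulr_ge0.
  have c4 : 0 <= 16 * T * (1 / 2) ^+ (a + uphalf k).
    by rewrite !mulr_ge0 ?exprn_ge0 ?divr_ge0.
  apply: (le_trans c2); rewrite -[leLHS]mulr1; apply: le_trans (ler_wpM2l c4 c3) _.
  rewrite /w la exprD.
  have := half_uphalf_bound R k; set X := (1 / 2) ^+ uphalf k; set Y := (3 / 4) ^+ k => XY.
  set Z := (1 / 2) ^+ a.
  have -> : 16 * T * (Z * X) * (4 * (a.+1%:R ^+ 2 * k.+1%:R ^+ 2) / r ^+ 2) =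
     (16 * T * Z * 4 * (a.+1%:R ^+ 2 * k.+1%:R ^+ 2) / r ^+ 2) * X by field; rewrite gt_eqF.
  have -> : T * (64 / r ^+ 2) * (k.+1%:R ^+ 2 * Y * (a.+1%:R ^+ 2 * Z)) =
     (16 * T * Z * 4 * (a.+1%:R ^+ 2 * k.+1%:R ^+ 2) / r ^+ 2) * Y by field; rewrite gt_eqF.
  by apply: ler_wpM2l => //; rewrite !mulr_ge0 ?invr_ge0 ?exprn_ge0 ?divr_ge0 ?(ltW r0).
(* Pairs (v, g) with v arbitrary and g bad are counted by their profiles. *)
have Scov : (#|bad| * Q ^ D <= \sum_(k < D.+1) \sum_(a < D.+1) \sum_(l < D.+1) #|S k a l|)%N.
  have -> : (#|bad| * Q ^ D = #|setX [set: 'rV[F]_n.+1] bad|)%N.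
    by rewrite cardsX cardsT card_mx mul1n mulnC.
  rewrite pair_bigA pair_bigA /=; apply: card_bigcup_le => -[v g]; rewrite inE /= => /andP[_ gb].
  have gG : g \in G by move: gb; rewrite inE => /andP[].
  have [k [b [l vO]]] := cov v g gG.
  have [le1 le2] := shape _ _ _ _ vO; rewrite -/D in le1 le2.
  have [kD aD lD] : [/\ (k < D.+1)%N, (D - (2 * k + b + l) < D.+1)%N & (l < D.+1)%N].
    by move: le1; clear; move: D => d; split; lia.
  exists (Ordinal kD, Ordinal aD, Ordinal lD) => /=; rewrite inE gb /=.
  have -> : (D - (2 * k + l + (D - (2 * k + b + l))) = b)%N.
    by move: le1; clear; move: D => d; lia.
  by rewrite vO /=; move: le1; clear; move: D => d; lia.
(* The a + 1 values l <= a raise the square of a + 1 to a cube, and the double sum over k and a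
   factors. *)
have wsum : \sum_(k < D.+1) \sum_(a < D.+1) \sum_(l < D.+1) w k a l <= 112 * 52.
  have wE (k a : 'I_D.+1) : \sum_(l < D.+1) w k a l =
      (k.+1%:R ^+ 2 * (3 / 4) ^+ k) * (a.+1%:R ^+ 3 * (1 / 2) ^+ a).
    set c := k.+1%:R ^+ 2 * (3 / 4) ^+ k * (a.+1%:R ^+ 2 * (1 / 2) ^+ a) : R.
    transitivity (\sum_(l < a.+1) c).
      rewrite [RHS](big_ord_widen D.+1 (fun=> c)) // [RHS]big_mkcond.
      by apply: eq_bigr => l _; rewrite /w ltnS.
    by rewrite sumr_const card_ord -mulr_natl /c; ring.
  under eq_bigr => k _ do (under eq_bigr => a _ do rewrite wE; rewrite -mulr_sumr).
  rewrite -mulr_suml; apply: ler_pM.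
  - by apply: sumr_ge0 => i _; rewrite mulr_ge0 ?exprn_ge0 ?divr_ge0.
  - by apply: sumr_ge0 => i _; rewrite mulr_ge0 ?exprn_ge0 ?divr_ge0.
  - exact: square_sum_bound.
  exact: cube_sum_bound.
have bound : #|bad|%:R / #|G|%:R <= 64 * 52 * 112 / r ^+ 2.
  have Gr0 : 0 < #|G|%:R :> R by rewrite ltr0n.
  have Qr0 : 0 < Q%:R ^+ D :> R by rewrite exprn_gt0 ?ltr0n // ltnW.
  rewrite ler_pdivrMr // -(ler_pM2r Qr0).
  apply: (@le_trans _ _ (T * (64 / r ^+ 2) * (112 * 52))).
    have := Scov; rewrite -(ler_nat R) natrM natrX => h; apply: (le_trans h).
    rewrite natr_sum; apply: (@le_trans _ _
      (\sum_(k < D.+1) \sum_(a < D.+1) \sum_(l < D.+1) T * (64 / r ^+ 2) * w k a l)).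
      apply: ler_sum => k _; rewrite natr_sum; apply: ler_sum => a _.
      by rewrite natr_sum; apply: ler_sum => l _.
    under eq_bigr => k _ do (under eq_bigr => a _ do rewrite -mulr_sumr; rewrite -mulr_sumr).
    rewrite -mulr_sumr ler_wpM2l //.
    by rewrite mulr_ge0 ?divr_ge0 ?exprn_ge0 // ltW.
  by rewrite le_eqVlt; apply/orP; left; apply/eqP; rewrite /T; field; rewrite gt_eqF.
rewrite lerBlDr; apply: le_trans (lerD (lexx _) bound).
rewrite /uniform_prob -mulrDl ler_pdivlMr ?ltr0n // mul1r -natrD ler_nat.
apply: leq_trans (leq_card_setU _ _); apply/subset_leq_card/subsetP=> g gG.
by rewrite !inE gG /= orbN.
Qed.

Lemma classical_group_bound (R : realType) (q n : nat) (F : finFieldType)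
    (m : nat) (G : {set 'M[F]_m}) :
  (0 < n)%N -> classical_group q n G -> forall r : R, 0 < r ->
  1 - 64 * 52 * 112 / r ^+ 2 <=
    uniform_prob R G (fun g : 'M[F]_m =>
      exists W : 'M[F]_m,
        (m - \rank W)%:R <= 16 + r /\ regular_semisimple_on g W).
Proof.
move=> n0 cG r r0.
case: F m G / cG => [F cF|F theta f cF tE uf|F f cF spf|F Q cF qQ nQ].
- case: n n0 => // n _; apply: cover_bound (@gl_cover F n) r r0.
  by rewrite inE unitmx1.
- case: n n0 f uf => // n _ f uf; have [Om cOm] := unitary_cover cF tE uf.
  apply: cover_bound cOm r r0; rewrite inE unitmx1.
  by apply/forallP=> u; apply/forallP=> v; rewrite !mulmx1.
- have : (0 < 2 * n)%N by rewrite muln_gt0.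
  move: (2 * n)%N f spf => -[] // m f spf _; have [Om cOm] := symplectic_cover spf.
  apply: cover_bound cOm r r0; rewrite inE unitmx1.
  by apply/forallP=> u; apply/forallP=> v; rewrite !mulmx1.
- case: n n0 Q qQ nQ => // n _ Q qQ nQ; have [Om cOm] := orthogonal_cover qQ nQ.
  apply: cover_bound cOm r r0; rewrite inE unitmx1.
  by apply/forallP=> u; rewrite mulmx1.
Qed.

Theorem theorem8p1 (R : realType) :
  exists c1 c2 : R,
    forall (q n : nat) (F : finFieldType) (m : nat) (G : {set 'M[F]_m}),
      (0 < n)%N -> classical_group q n G ->
    forall r : R, 0 < r ->
      1 - c2 / r ^+ 2 <=
        uniform_prob R G (fun g : 'M[F]_m =>
          exists W : 'M[F]_m,
            (m - \rank W)%:R <= c1 + r /\ regular_semisimple_on g W).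
Proof.
(* 16 is twice the threshold 8 for a + k; 52 and 112 bound the sums over a and k. *)
exists 16, (64 * 52 * 112) => q n F m G n0 cG r r0.
exact: classical_group_bound cG r r0.
Qed.
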